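(* Let $k$ be any field and let $G$ be any graph (possibly infinite). Then the finite cycle matroid $M_{FC}(G)$, the bond matroid $M_B(G)$, the finite bond matroid $M_{FB}(G)$ and the topological cycle matroid $M_C(G)$ are all tame thin sums matroids over $k$. Moreover, whenever the algebraic cycle system $M_A(G)$ is a matroid, both the algebraic cycle matroid $M_A(G)$ and its dual $M_A^*(G)$ (the skew cuts matroid of $G$) are tame thin sums matroids over $k$.
   Context: A matroid $M$ consists of a (possibly infinite) ground set $E$ and a set $\mathcal I$ of subsets of $E$ (the independent sets) such that: (I1) $\emptyset\in\mathcal I$; (I2) $\mathcal I$ is closed under taking subsets; (I3) for every non-maximal $I\in\mathcal I$ and every maximal $I'\in\mathcal I$ there is $x\in I'\setminus I$ with $I\cup\{x\}\in\mathcal I$; (IM) whenever $I\subseteq X\subseteq E$ and $I\in\mathcal I$, the set $\{I'\in\mathcal I : I\subseteq I'\subseteq X\}$ has a maximal element. Bases are maximal independent sets; circuits are minimal dependent (non-independent) sets. The dual $M^*$ is the matroid on $E$ whose bases are the complements of the bases of $M$; cocircuits of $M$ are circuits of $M^*$. A matroid is tame if the intersection of any circuit with any cocircuit is finite. Thin sums: for a set $A$ and a map $f\colon E\to k^A$, a thin dependence of $f$ is a map $c\colon E\to k$ such that for each $a\in A$ we have $\sum_{e\in E}c(e)f(e)(a)=0$ (including the requirement that, for each $a$, only finitely many summands are nonzero). The thin sums system $M_{ts}(f)$ is the set system on $E$ in which a subset is independent iff there is no nonzero thin dependence of $f$ that is zero outside that subset. A matroid $M$ on $E$ is a thin sums matroid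 over $k$ if $M=M_{ts}(f)$ for some set $A$ and some $f\colon E\to k^A$. Graphic matroids (all on the edge set $E(G)$): a cut is the set of all edges between the two sides of a bipartition of the vertex set; a bond is a minimal nonempty cut. $M_{FC}(G)$ is the matroid whose circuits are the edge sets of (finite) cycles of $G$; $M_B(G)$ is the matroid whose circuits are the (possibly infinite) bonds of $G$, and it is the dual of $M_{FC}(G)$; $M_{FB}(G)$ is the matroid whose circuits are the finite bonds of $G$; $M_C(G)$ is the dual of $M_{FB}(G)$. The algebraic cycle system $M_A(G)$ is the set system on $E(G)$ in which a set of edges is independent iff it includes neither the edge set of a cycle nor the edge set of a double ray (two-way infinite path) of $G$. *)

(* Defs.v *)
From mathcomp Require Import all_boot all_order all_algebra.
From mathcomp Require Import boolp classical_sets functions cardinality fsbigop.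

Set Implicit Arguments.
Unset Strict Implicit.
Unset Printing Implicit Defensive.

Local Open Scope classical_set_scope.
Local Open Scope ring_scope.

(** * Set systems and infinite matroids *)

Section SetSystems.
Variable E : Type.
Implicit Types (F M : set (set E)) (I X : set E).

Definition maximal_in F X := F X /\ forall Y, F Y -> X `<=` Y -> Y = X.

Definition minimal_in F X := F X /\ forall Y, F Y -> Y `<=` X -> Y = X.

(** A set system on [E] is given by its collection of independent sets;
    the ground set is all of [E]. *)
Record is_matroid M : Prop := IsMatroid {
  indep0 : M set0;
  indepS : forall I J, J `<=` I -> M I -> M J;
  indep_augment : forall I I', M I -> ~ maximal_in M I -> maximal_in M I' ->
    exists2 x, (I' `\` I) x & M (I `|` [set x]);
  indep_maximal : forall I X, M I -> I `<=` X ->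
    exists I', maximal_in [set J | [/\ M J, I `<=` J & J `<=` X]] I' }.

Definition bases M : set (set E) := maximal_in M.

Definition circuits M : set (set E) := minimal_in (~` M).

(** When [M] is a matroid the bases of [dual M] are exactly the complements
    of the bases of [M]. *)
Definition dual M : set (set E) :=
  [set I | exists2 B, bases M B & I `<=` ~` B].

Definition cocircuits M : set (set E) := circuits (dual M).

Definition tame M :=
  forall C D, circuits M C -> cocircuits M D -> finite_set (C `&` D).

(** In a matroid every dependent set includes a circuit, so a matroid whose
    collection of circuits is [C] must be this set system. *)
Definition with_circuits (C : set (set E)) : set (set E) :=
  [set I | forall X, C X -> ~ (X `<=` I)].

Lemma circuits_with_circuits (C : set (set E)) : (forall X, C X -> minimal_in C X) ->
  circuits (with_circuits C) = C.
Proof.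
move=> Cmin; apply/seteqP; split=> X.
- move=> [/existsNP[Y /not_implyP[CY /contrapT YX]] Xmin].
  suff <- : Y = X by [].
  by apply: Xmin YX => nY; apply: (nY Y CY).
- move=> CX; split=> [nX|Y /existsNP[Z /not_implyP[CZ /contrapT ZY]] YX].
    exact: (nX X CX).
  have ZX : Z = X by apply: (Cmin X CX).2 => //; apply: subset_trans YX.
  by apply/seteqP; split=> //; rewrite -ZX.
Qed.

End SetSystems.

(** * Thin sums *)

Section ThinSums.
Variables (k : fieldType) (E : Type).

(** [\sum_(_ \in _)] is a sum over a finite support with a junk value when the
    support is infinite, hence the separate finiteness clause; [{classic E}]
    is [E] with the choice structure that it requires. *)
Definition thin_dependence (A : Type) (f : E -> A -> k) (c : E -> k) : Prop :=
  forall a : A,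
    finite_set [set e : E | c e * f e a != 0] /\
    \sum_(e \in [set: {classic E}]) c e * f e a = 0.

Definition thin_sums (A : Type) (f : E -> A -> k) : set (set E) :=
  [set X | ~ exists c : E -> k,
     [/\ thin_dependence f c,
         exists e, c e != 0
       & forall e, ~ X e -> c e = 0]].

Definition thin_sums_matroid (M : set (set E)) : Prop :=
  is_matroid M /\ exists (A : Type) (f : E -> A -> k), M = thin_sums f.

Definition tame_thin_sums_matroid (M : set (set E)) : Prop :=
  thin_sums_matroid M /\ tame M.

End ThinSums.

(** * Graphs *)

(** Undirected, of any cardinality, with loops and parallel edges allowed:
    [ends e] is the set of the one or two endvertices of [e]. *)
Record graph := Graph {
  vertex : Type;
  edge : Type;
  ends : edge -> set vertex;
  endsP : forall e, exists u v, ends e = [set u; v] }.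

Section GraphMatroids.
Variable G : graph.
Implicit Type F : set (edge G).

(** A cycle of length [n.+1]; indices are read cyclically through [ordS].
    Length 1 is a loop, and length 2 is a pair of parallel edges, for which
    the injectivity of [e] is not a consequence of that of [v]. *)
Definition cycle_edges F : Prop :=
  exists n (v : 'I_n.+1 -> vertex G) (e : 'I_n.+1 -> edge G),
    [/\ injective v, injective e,
        forall i, ends (e i) = [set v i; v (ordS i)]
      & F = range e].

Definition double_ray_edges F : Prop :=
  exists (v : int -> vertex G) (e : int -> edge G),
    [/\ injective v,
        forall i, ends (e i) = [set v i; v (i + 1)]
      & F = range e].

Definition cut F : Prop :=
  exists S : set (vertex G),
    F = [set e | ends e `&` S !=set0 /\ ends e `&` ~` S !=set0].

Definition bond : set (set (edge G)) :=
  minimal_in [set F | cut F /\ F !=set0].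

Definition M_FC : set (set (edge G)) := with_circuits cycle_edges.

Definition M_B : set (set (edge G)) := with_circuits bond.

Definition M_FB : set (set (edge G)) :=
  with_circuits [set F | bond F /\ finite_set F].

Definition M_C : set (set (edge G)) := dual M_FB.

Definition M_A : set (set (edge G)) :=
  [set I | forall F, cycle_edges F \/ double_ray_edges F -> ~ (F `<=` I)].

End GraphMatroids.

Arguments M_FC : clear implicits.
Arguments M_B : clear implicits.
Arguments M_FB : clear implicits.
Arguments M_C : clear implicits.
Arguments M_A : clear implicits.

(* Main.v *)
Require Import Defs.
From mathcomp Require Import all_boot all_order all_algebra.
From mathcomp Require Import boolp classical_sets functions cardinality fsbigop.
From mathcomp Require Import zify.

(** Every matroid with an orthogonal painting is tame and a thin sums matroid.
    A painting gives each circuit and each cocircuit a function to [k] with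
    exactly this support, such that every circuit is orthogonal to every
    cocircuit, by a sum with finitely many nonzero terms. The representation
    has one coordinate for each cocircuit: circuits are thin dependences by
    orthogonality, and no thin dependence lives inside a base because it would
    meet some fundamental cocircuit in a single edge
    ([painted_tame_thin_sums]). As the notion is self-dual ([painted_dual]) and
    duals of matroids are matroids ([dual_matroid]), it remains to paint
    [M_FC], [M_FB] and [M_A], and to identify [M_B] as the dual of [M_FC]
    ([M_B_dual]).

    The circuits of [M_FC] are the minimal supports of nonzero finite flows, and
    those of [M_FB] are the minimal supports of nonzero finitely supported
    coboundaries. Any space of finitely supported functions defines a matroid in
    this way, and linear elimination yields functions orthogonal to the space that
    paint the cocircuits ([indep_of_matroid], [indep_of_painted]).

    For [M_A], cycles and double rays carry flows of value 1 or -1. Each cocircuit is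
    a cut around the vertex set of a rayless tree ([M_A_cocircuit]), and it is
    painted by the coboundary of the indicator function of this set. A double ray
    whose tails both avoid the set is orthogonal to this coboundary by
    telescoping, and it meets the cut finitely. That the tails avoid the set is
    where the hypothesis that [M_A] is a matroid enters: a rayless tree with
    infinitely many vertices on a double ray has a vertex with infinitely many
    branches that meet the double ray ([star_vertex]), which produces a
    subdivision of a graph whose algebraic cycle system is not a matroid
    ([no_bean], [ray_meets_rayless_finitely]). *)

Set Implicit Arguments.
Unset Strict Implicit.
Unset Printing Implicit Defensive.

Import Order.TTheory GRing.Theory.

Local Open Scope classical_set_scope.
Local Open Scope ring_scope.

(** * Infinite matroids *)

Section Matroids.
Variables (E : Type) (M : set (set E)).
Implicit Types (I J X Z B C D : set E).

Lemma not_indep_add B x : bases M B -> ~ B x -> ~ M (B `|` [set x]).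
Proof.
move=> [_ Bmax] nBx Mx; apply: nBx.
by rewrite -(Bmax _ Mx (@subsetUl _ _ _)); right.
Qed.

Lemma bases_antichain B B' : bases M B -> bases M B' -> B `<=` B' -> B' = B.
Proof. by move=> [_ Bmax] [MB' _] /(Bmax _ MB'). Qed.

Hypothesis matM : is_matroid M.

(** The set given by the maximality axiom is a base: otherwise an element of [B]
    could be added to it. *)
Lemma base_between I B Z : M I -> I `<=` Z -> bases M B -> B `<=` Z ->
  exists J, [/\ bases M J, I `<=` J & J `<=` Z].
Proof.
move=> MI IZ bB BZ; have [J [[MJ IJ JZ] Jmax]] := indep_maximal matM MI IZ.
exists J; split=> //; apply: contrapT => nJ.
have [x [Bx nJx] MJx] := indep_augment matM MJ nJ bB.
apply: nJx; rewrite -(Jmax (J `|` [set x])); first by right.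
- split=> //; first by apply: subset_trans IJ (@subsetUl _ _ _).
  by move=> y [/JZ|->] //; apply: BZ.
- by left.
Qed.

Lemma base_exists : exists B, bases M B.
Proof.
have [B [[MB _ _] Bmax]] := indep_maximal matM (indep0 matM) (@sub0set _ setT).
by exists B; split=> // Y MY BY; apply: Bmax => //; split=> //; apply: sub0set.
Qed.

Lemma base_extend I : M I -> exists2 B, bases M B & I `<=` B.
Proof.
have [B bB] := base_exists => MI.
have [||J [bJ IJ _]] := @base_between I B setT MI _ bB => //.
by exists J.
Qed.

(** For [I] maximal independent in [X] and [e] in [X - I], the circuit is the set
    [C] of the elements whose removal makes [I + e] independent. If [C] were
    independent, it would extend to a base inside [B + e], where [B] is a base that
    includes [I]. Some [x] in [I] is missing from this base, and exchange shows
    that [B - x + e] is independent, so that [x] is in [C] after all. *)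
Lemma dependent_circuit X : ~ M X -> exists2 C, circuits M C & C `<=` X.
Proof.
move=> nMX; have [I [[MI _ IX] Imax]] := indep_maximal matM (indep0 matM) (@sub0set _ X).
have [e Xe nIe] : exists2 e, X e & ~ I e.
  apply: contrapT => /forall2NP nex; apply: nMX.
  suff -> : X = I by [].
  by apply/seteqP; split=> // x Xx; case: (nex x) => // /contrapT.
pose Ie := I `|` [set e].
have nMIe : ~ M Ie.
  move=> MIe; apply: nIe; rewrite -(Imax Ie); first by right.
    by split=> // x [/IX|->].
  by left.
pose C := [set x | Ie x /\ M (Ie `\ x)].
have Ce : C e.
  split; first by right.
  by apply: (indepS matM _ MI) => x [[//|->]] /(_ erefl).
have CIe : C `<=` Ie by move=> x [].
exists C; last by move=> x /CIe [/IX|->].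
split=> [MC|Y nMY YC]; last first.
  apply/seteqP; split=> // x Cx; apply: contrapT => nYx.
  case: (Cx) => _ MIx; apply: nMY; apply: (indepS matM _ MIx) => y Yy.
  by split; [apply/CIe/YC|move=> yx; apply: nYx; rewrite -yx].
have [J [[MJ CJ JIe] Jmax]] := indep_maximal matM MC CIe.
have [x Iex nJx] : exists2 x, Ie x & ~ J x.
  apply: contrapT => /forall2NP nex; apply: nMIe; apply: (indepS matM _ MJ) => x Iex.
  by case: (nex x) => // /contrapT.
have [B bB IB] := base_extend MI.
have JBe : J `<=` B `|` [set e] by move=> y /JIe [/IB|]; [left|right].
have [|J' [bJ' JJ' J'Be]] := @base_between J B (B `|` [set e]) MJ JBe bB.
  exact: subsetUl.
have nJ'x : ~ J' x.
  move=> J'x; apply: nJx; rewrite -(Jmax (J `|` [set x])); first by right.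
    split; last by move=> y [/JIe|->].
      by apply: (indepS matM _ bJ'.1) => y [/JJ'|->].
    by move=> y /CJ; left.
  by left.
have Bx : B x by case: Iex => [/IB //|xe]; case: nJx; rewrite xe; apply: CJ.
have MBx : M (B `\ x) by apply: (indepS matM _ bB.1) => y [].
have nBx : ~ maximal_in M (B `\ x).
  by move=> [_ /(_ B bB.1 (@subDsetl _ _ _))] Bxx; move: Bx; rewrite Bxx => -[_ /(_ erefl)].
have [y [J'y nBy] MBxy] := indep_augment matM MBx nBx bJ'.
have ye : y = e.
  case: (J'Be _ J'y) => // By; exfalso; apply: nBy; split=> // yx.
  by apply: nJ'x; rewrite -yx.
apply: nJx; apply: CJ; split=> //; apply: (indepS matM _ MBxy) => z [[Iz|->] zx].
  by left; split=> //; apply: IB.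
by right; rewrite ye.
Qed.

Lemma fundamental_circuit B f : bases M B -> ~ B f ->
  exists C, [/\ circuits M C, C `<=` B `|` [set f] & C f].
Proof.
move=> bB nBf; have [C cC CB] := dependent_circuit (not_indep_add bB nBf).
exists C; split=> //; apply: contrapT => nCf; apply: cC.1.
by apply: (indepS matM _ bB.1) => x Cx; case: (CB _ Cx) => // xf; case: nCf; rewrite -xf.
Qed.

(** If [C] and [D] had only [e] in common, a base avoiding [D - e] and including
    [C - e] could not contain [e], hence would avoid [D]. *)
Lemma circuit_cocircuit_neq1 C D e : circuits M C -> cocircuits M D ->
  C `&` D <> [set e].
Proof.
move=> [nMC Cmin] [nD Dmin] CDe.
have [Ce De] : (C `&` D) e by rewrite CDe.
have [B bB DB] : dual M (D `\ e).
  apply: contrapT => nDe.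
  by move: De; rewrite -(Dmin _ nDe (@subDsetl _ _ _)) => -[_ /(_ erefl)].
have MCe : M (C `\ e).
  apply: contrapT => nCe.
  by move: Ce; rewrite -(Cmin _ nCe (@subDsetl _ _ _)) => -[_ /(_ erefl)].
have [||J [bJ CJ JD]] := @base_between (C `\ e) B (~` (D `\ e)) MCe _ bB.
- by move=> x [Cx xe] [Dx _]; apply: xe; have : (C `&` D) x by []; rewrite CDe.
- by move=> x Bx /DB; apply.
have nJe : ~ J e.
  move=> Je; apply: nMC; apply: (indepS matM _ bJ.1) => x Cx.
  by have [->//|xe] := pselect (x = e); apply: CJ.
apply: nD; exists J => // x Dx Jx; apply: (JD x Jx); split=> // xe.
by apply: nJe; rewrite -xe.
Qed.

(** ** Duality *)

Lemma bases_dual B : bases (dual M) B <-> bases M (~` B).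
Proof.
split=> [[[B' bB' BB'] Bmax]|bB].
  suff <- : ~` B' = B by rewrite setCK.
  by apply: Bmax => //; exists B'.
split=> [|Y [B' bB' YB'] BY]; first by exists (~` B) => //; rewrite setCK.
apply/seteqP; split=> // x Yx; apply: contrapT => nBx.
have B'B : B' `<=` ~` B by move=> y B'y By; apply: (YB' y) => //; apply: BY.
by apply: (YB' x Yx); rewrite -(bases_antichain bB' bB B'B).
Qed.

Lemma dual_dual : dual (dual M) = M.
Proof.
apply/seteqP; split=> I.
  by move=> [B /bases_dual bB IB]; apply: (indepS matM _ bB.1).
move=> MI; have [B bB IB] := base_extend MI; exists (~` B); rewrite ?setCK //.
by apply/bases_dual; rewrite setCK.
Qed.

(** Exchange: a base between [B - I] and the complement of [I], with [B] the
    complement of [I'], is a proper subset of this complement if [I] is not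
    maximal. Maximal extensions: a base outside [I] whose part outside [X] is maximal
    is as small as possible inside [X]. *)
Lemma dual_matroid : is_matroid (dual M).
Proof.
split.
- by have [B bB] := base_exists; exists B.
- by move=> I J JI [B bB IB]; exists B => //; apply: subset_trans JI IB.
- move=> I I' [B1 bB1 IB1] nImax /bases_dual bI'; set B := ~` I' in bI'.
  have [|||B2 [bB2 BB2 B2I]] := @base_between (B `\` I) B1 (~` I) _ _ bB1.
  + by apply: (indepS matM _ bI'.1) => x [].
  + by move=> x [].
  + by move=> x B1x Ix; apply: (IB1 x).
  have [x nIx nB2x] : exists2 x, ~ I x & ~ B2 x.
    apply: contrapT => /forall2NP nex; apply: nImax; apply/bases_dual.
    suff -> : ~` I = B2 by [].
    by apply/seteqP; split=> // x nIx; case: (nex x) => // /contrapT.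
  exists x; last by exists B2 => // y [Iy B2y|-> //]; apply: (B2I y).
  by split=> //; apply: contrapT => nI'x; apply: nB2x; apply: BB2.
- move=> I X [B1 bB1 IB1] IX.
  have [K [[MK _ KX] Kmax]] := indep_maximal matM (indep0 matM) (@sub0set _ (~` X)).
  have [||K2 [bK2 KK2 K2I]] := @base_between K B1 (~` I) MK _ bB1.
  + by move=> x /KX nXx Ix; apply/nXx/IX.
  + by move=> x B1x Ix; apply: (IB1 x).
  exists (X `\` K2); split=> [|J' [[B' bB' J'B'] IJ' J'X] JJ'].
    split; [by exists K2 => // x []| |by move=> x []].
    by move=> x Ix; split; [apply: IX|move=> /K2I].
  apply/seteqP; split=> // x J'x; apply: contrapT => nx.
  have K2x : K2 x by apply: contrapT => nK2x; apply: nx; split=> //; apply: J'X.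
  have MKx : M (K2 `\ x) by apply: (indepS matM _ bK2.1) => y [].
  have nKx : ~ maximal_in M (K2 `\ x).
    move=> [_ /(_ K2 bK2.1 (@subDsetl _ _ _))] Kxx.
    by move: K2x; rewrite Kxx => -[_ /(_ erefl)].
  have [y [B'y nK2y] MKxy] := indep_augment matM MKx nKx bB'.
  have nK2y' : ~ K2 y.
    by move=> K2y; apply: nK2y; split=> // yx; apply: (J'B' x J'x); rewrite -yx.
  have nXy : ~ X y by move=> Xy; apply: (J'B' y) => //; apply: JJ'.
  apply/nK2y'/(KK2); rewrite -(Kmax (K `|` [set y])); first by right.
    split=> //; last by move=> z [/KX|->].
    apply: (indepS matM _ MKxy) => z [Kz|->]; last by right.
    by left; split; [apply: KK2|move=> zx; apply: (KX z Kz); rewrite zx; apply: J'X].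
  by left.
Qed.

End Matroids.

Section Cocircuits.
Variables (E : Type) (M : set (set E)).
Hypothesis matM : is_matroid M.
Implicit Types (B C D : set E).

Lemma cocircuits_dual : cocircuits (dual M) = circuits M.
Proof. by rewrite /cocircuits dual_dual. Qed.

Lemma circuit_nonempty C : circuits M C -> exists e, C e.
Proof.
move=> [nMC _]; apply: contrapT => nC; apply: nMC.
suff -> : C = set0 by apply: indep0.
by apply/seteqP; split=> // x Cx; apply: nC; exists x.
Qed.

Lemma fundamental_cocircuit B e : bases M B -> B e ->
  exists D, [/\ cocircuits M D, D e & D `&` B = [set e]].
Proof.
move=> bB Be; have bC : bases (dual M) (~` B) by apply/bases_dual; rewrite setCK.
have [|D [cD DB De]] := @fundamental_circuit _ _ (dual_matroid matM) _ e bC.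
  by apply.
exists D; split=> //; apply/seteqP; split=> x; last by move=> ->.
by move=> [Dx Bx]; case: (DB x Dx).
Qed.

Lemma cocircuit_base D e : cocircuits M D -> D e ->
  exists2 B, bases M B & D `&` B = [set e].
Proof.
move=> [nD Dmin] De.
have [B bB DB] : dual M (D `\ e).
  apply: contrapT => nDe.
  by move: De; rewrite -(Dmin _ nDe (@subDsetl _ _ _)) => -[_ /(_ erefl)].
exists B => //; apply/seteqP; split=> x.
  by move=> [Dx Bx]; apply: contrapT => xe; apply: (DB x).
move=> ->; split=> //; apply: contrapT => nBe; apply: nD; exists B => // y Dy By.
by apply: (DB y) => //; split=> // ye; apply: nBe; rewrite -ye.
Qed.

(** For [f] outside [B], membership in [D'] is decided by the fundamental
    circuit of [f]: it meets [D'] at most in [e] and [f], hence in both or in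
    none. The same holds for [D]. *)
Lemma fundamental_cocircuit_unique B D D' e : bases M B -> cocircuits M D ->
    D `&` B = [set e] -> D' `&` B = [set e] ->
    (forall f C g, circuits M C -> C `<=` B `|` [set f] -> C `&` D' <> [set g]) ->
  D = D'.
Proof.
move=> bB cD DB D'B orth.
have half (D1 D2 : set E) f : D1 `&` B = [set e] -> D2 `&` B = [set e] ->
    (forall C g, circuits M C -> C `<=` B `|` [set f] -> C `&` D1 <> [set g]) ->
    (forall C g, circuits M C -> C `<=` B `|` [set f] -> C `&` D2 <> [set g]) ->
    D1 f -> D2 f.
  move=> D1B D2B o1 o2 D1f; have [Bf|nBf] := pselect (B f).
    have : (D1 `&` B) f by [].
    by rewrite D1B -D2B => -[].
  have [C [cC CB Cf]] := fundamental_circuit matM bB nBf.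
  have Ce : C e.
    apply: contrapT => nCe; apply: (o1 C f cC CB); apply/seteqP; split=> x; last by move=> ->.
    move=> [Cx D1x]; case: (CB x Cx) => // Bx; exfalso.
    have : (D1 `&` B) x by []; rewrite D1B => xe; by apply: nCe; rewrite -xe.
  apply: contrapT => nD2f; apply: (o2 C e cC CB); apply/seteqP; split=> x.
    move=> [Cx D2x]; have : (D2 `&` B) x; last by rewrite D2B.
    by split=> //; case: (CB x Cx) => // xf; case: nD2f; rewrite -xf.
  by move=> ->; split=> //; have [] : (D2 `&` B) e by rewrite D2B.
have orthD f C g : circuits M C -> C `<=` B `|` [set f] -> C `&` D <> [set g].
  by move=> cC _; apply: (circuit_cocircuit_neq1 matM cC cD).
by apply/seteqP; split=> f; apply: half => // C g;
  first [exact: orthD | exact: orth].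
Qed.

End Cocircuits.

(** * Orthogonal paintings *)

Section Painting.
Variables (k : fieldType) (E : Type).
Implicit Types (c d : E -> k) (M : set (set E)).

Definition supp c : set E := [set e | c e != 0].

Definition dot c d : k := \sum_(e \in [set: {classic E}]) c e * d e.

Definition orth c d : Prop :=
  finite_set [set e | c e * d e != 0] /\ dot c d = 0.

Lemma suppPn c e : ~ supp c e -> c e = 0.
Proof. by move=> /negP; rewrite negbK => /eqP. Qed.

Lemma dotC c d : dot c d = dot d c.
Proof. by apply: eq_fsbigr => e _; rewrite mulrC. Qed.

Lemma orthC c d : orth c d -> orth d c.
Proof.
move=> [fcd cd0]; split; last by rewrite dotC.
by under eq_set do rewrite mulrC.
Qed.

Lemma dot_widen (A : set {classic E}) c d : (forall e, ~ A e -> c e * d e = 0) ->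
  dot c d = \sum_(e \in A) c e * d e.
Proof. by move=> cd0; apply/esym/fsbig_widen => // e [_ /cd0]. Qed.

Lemma dot1 c d e : (forall e', e' <> e -> c e' * d e' = 0) -> dot c d = c e * d e.
Proof. by move=> cd0; rewrite (@dot_widen [set e]) ?fsbig_set1. Qed.

Lemma dotBZ a c c' d : finite_set (supp c) -> finite_set (supp c') ->
  dot (fun e => c e - a * c' e) d = dot c d - a * dot c' d.
Proof.
move=> fc fc'; pose A : set {classic E} := supp c `|` supp c'.
have fA : finite_set A by rewrite finite_setU.
have A0 e : ~ A e -> c e = 0 /\ c' e = 0.
  by move=> /not_orP[/suppPn -> /suppPn ->].
rewrite (@dot_widen A (fun e => _)); last first.
  by move=> e /A0[-> ->]; rewrite mulr0 subr0 mul0r.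
rewrite (@dot_widen A c); last by move=> e /A0[-> _]; rewrite mul0r.
rewrite (@dot_widen A c'); last by move=> e /A0[_ ->]; rewrite mul0r.
rewrite -mulNr mulr_fsumr -fsbig_split //.
by apply: eq_fsbigr => e _; rewrite mulrBl mulNr mulrA.
Qed.

Lemma orth_neq1 c d e : orth c d -> supp c `&` supp d <> [set e].
Proof.
move=> [_ cd0] cde; have [] : (supp c `&` supp d) e by rewrite cde.
move=> /= ce de; have : c e * d e != 0 by rewrite mulf_neq0.
rewrite -(dot1 (e := e)) ?cd0 ?eqxx // => e' e'e.
apply/eqP; apply: contrapT => /negP; rewrite mulf_eq0 negb_or => /andP[ce' de'].
by apply: e'e; have : (supp c `&` supp d) e' by []; rewrite cde.
Qed.

(** Coefficients for all circuits and all cocircuits at once, such that every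
    circuit is orthogonal to every cocircuit. *)
Definition painted M : Prop := exists CC DD : set (E -> k),
  [/\ forall C, circuits M C -> exists2 c, CC c & supp c = C,
      forall D, cocircuits M D -> exists2 d, DD d & supp d = D
    & forall c d, CC c -> DD d -> orth c d].

Lemma painted_dual M : is_matroid M -> painted M -> painted (dual M).
Proof.
move=> matM [CC [DD [cC cD cd]]]; exists DD, CC; split=> [C|D|c d Dc Cd].
- exact: cD.
- by rewrite cocircuits_dual //; apply: cC.
- by apply/orthC/cd.
Qed.

(** The coordinates of the thin sums representation are the cocircuits. A circuit
    is a thin dependence by orthogonality. A thin dependence cannot be supported
    inside a base [B]: at an [e] of its support, it would meet the fundamental
    cocircuit of [e] exactly in [e]. *)
Lemma painted_tame_thin_sums M : is_matroid M -> painted M ->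
  tame_thin_sums_matroid k M.
Proof.
move=> matM [CC [DD [cC cD cd]]]; split; last first.
  move=> C D /cC[c Cc <-] /cD[d Dd <-]; have [fcd _] := cd c d Cc Dd.
  by apply: sub_finite_set fcd => e [/= ce de]; rewrite mulf_neq0.
split=> //; exists {d | DD d}, (fun e (d : {d | DD d}) => sval d e).
apply/seteqP; split=> X.
  move=> MX [c [cdep [e /= ce] cX]].
  have [B bB XB] := base_extend matM MX.
  have Xe : X e by apply: contrapT => /cX c0; rewrite c0 eqxx in ce.
  have [D [ccD De DB]] := fundamental_cocircuit matM bB (XB _ Xe).
  have [d Dd dD] := cD D ccD.
  apply: (@orth_neq1 c d e (cdep (exist _ d Dd))).
  rewrite dD -DB; apply/seteqP; split=> x [].
    move=> cx Dx; split=> //; apply: XB; apply: contrapT => /cX c0.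
    by move: cx; rewrite /supp /= c0 eqxx.
  by move=> Dx Bx; have -> : x = e by have : (D `&` B) x by []; rewrite DB.
move=> tX; apply: contrapT => /(dependent_circuit matM)[C ccC CX].
have [c Cc cC'] := cC C ccC; have [e Ce] := circuit_nonempty matM ccC.
apply: tX; exists c; split=> [[d Dd] /=||x nXx].
- exact: cd.
- by exists e; rewrite -cC' in Ce.
- by apply: suppPn; rewrite cC' => /CX.
Qed.

End Painting.

(** * Independence with respect to a space of finitely supported functions *)

Section FiniteVectors.
Variables (k : fieldType) (E : Type) (W : set (E -> k)).
Implicit Types (w c d : E -> k) (I B X : set E).

(** The minimal dependent sets are the minimal supports of nonzero elements of
    [W]. *)
Definition indep_of : set (set E) :=
  [set I | forall w, W w -> supp w `<=` I -> forall e, w e = 0].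

Hypothesis Wfin : forall w, W w -> finite_set (supp w).
Hypothesis WBZ : forall a w w', W w -> W w' -> W (fun e => w e - a * w' e).

Lemma W0 w : W w -> W (fun=> 0).
Proof.
move=> Ww; have := WBZ 1 Ww Ww.
by under [fun e => _]eq_fun do rewrite mul1r subrr.
Qed.

Lemma dependent_vector I f : indep_of I -> ~ indep_of (I `|` [set f]) ->
  exists w, [/\ W w, w f = 1 & supp w `<=` I `|` [set f]].
Proof.
move=> iI /existsNP[w /not_implyP[Ww /not_implyP[wI /existsNP[e we]]]].
have wf : w f != 0.
  apply/negP => /eqP wf; apply: we; apply: iI => // x wx.
  by case: (wI x wx) => // xf; move: wx; rewrite /supp /= xf wf eqxx.
exists (fun e => 0 - (- (w f)^-1) * w e); split; first by apply: WBZ => //; apply: W0 Ww.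
  by rewrite sub0r mulNr opprK mulVf.
move=> x /= wx; apply: wI; apply: contra_neq wx => ->.
by rewrite mulr0 subrr.
Qed.

(** Successive subtraction of multiples of the [u x] clears the coordinates [x]
    in the list without changing the coordinates outside [I] and the list. *)
Lemma eliminate I (T : set E) (u : E -> E -> k) w (s : seq {classic E}) :
    (forall x, T x -> [/\ W (u x), u x x = 1 & supp (u x) `<=` I `|` [set x]]) ->
    (forall x, T x -> ~ I x) -> (forall x, x \in s -> T x) -> W w ->
  exists w', [/\ W w', forall y : {classic E}, ~ I y -> y \notin s -> w' y = w y,
    forall y, y \in s -> w' y = 0
    & forall d, (forall x, T x -> dot (u x) d = 0) -> dot w' d = dot w d].
Proof.
move=> uP TI + Ww; elim: s => [_|x s IHs sT]; first by exists w.
have [|w' [Ww' w'y w's w'd]] := IHs.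
  by move=> y ys; apply: sT; rewrite in_cons ys orbT.
have Tx : T x by apply: sT; rewrite in_cons eqxx.
have [Wux uxx uxI] := uP x Tx.
have ux0 y : ~ I y -> y <> x -> u x y = 0.
  by move=> nIy yx; apply: suppPn => /uxI[].
exists (fun e => w' e - w' x * u x e); split.
- exact: WBZ.
- move=> y nIy; rewrite in_cons negb_or => /andP[/eqP yx ys].
  by rewrite ux0 // mulr0 subr0 w'y.
- move=> y; have [-> _|yx] := pselect (y = x); first by rewrite uxx mulr1 subrr.
  rewrite in_cons => /orP[/eqP //|ys]; rewrite ux0 ?mulr0 ?subr0 ?w's //.
  by apply/TI/sT; rewrite in_cons ys orbT.
- by move=> d ud; rewrite dotBZ ?w'd ?ud ?mulr0 ?subr0 //; apply: Wfin.
Qed.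

Lemma eliminate_outside I (u : E -> E -> k) w :
    (forall x, ~ I x -> supp w x ->
      [/\ W (u x), u x x = 1 & supp (u x) `<=` I `|` [set x]]) -> W w ->
  exists w', [/\ W w', supp w' `<=` I
    & forall d, (forall x, ~ I x -> supp w x -> dot (u x) d = 0) -> dot w' d = dot w d].
Proof.
move=> uP Ww; have fT : finite_set (supp w `\` I : set {classic E}).
  by apply: sub_finite_set (Wfin Ww) => x [].
have [s sT] := (finite_seqP _).1 fT.
have sP x : x \in s -> (supp w `\` I) x by rewrite sT.
have [||||w' [Ww' w'y w's w'd]] := @eliminate I (supp w `\` I) u w s.
- by move=> x [wx nIx]; apply: uP.
- by move=> x [].
- by [].
- by [].
exists w'; split=> // [y|d ud]; last by apply: w'd => x [wx nIx]; apply: ud.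
move=> /negP w'y0; apply: contrapT => nIy; apply: w'y0.
have [ys|ys] := boolP ((y : {classic E}) \in s); first by rewrite w's.
rewrite w'y //; apply: contrapT => /negP wy.
have : (supp w `\` I) y by [].
by rewrite sT /= (negbTE ys).
Qed.

Lemma chain_cover I (F : set (set E)) (s : seq {classic E}) :
    total_on F subset -> (forall x, x \in s -> (I `|` \bigcup_(X in F) X) x) ->
  (forall x, x \in s -> I x) \/ exists2 X, F X & forall x, x \in s -> (I `|` X) x.
Proof.
move=> Ftot; elim: s => [|x s IHs] sI; first by left.
have [|sI'|[X FX sX]] := IHs; first by move=> y ys; apply: sI; rewrite in_cons ys orbT.
  case: (sI x (mem_head _ _)) => [Ix|[X FX Xx]].
    by left=> y; rewrite in_cons => /orP[/eqP ->|/sI'].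
  by right; exists X => // y; rewrite in_cons => /orP[/eqP ->|/sI']; [right|left].
right; case: (sI x (mem_head _ _)) => [Ix|[Y FY Yx]].
  by exists X => // y; rewrite in_cons => /orP[/eqP ->|/sX]; first by left.
case: (Ftot X Y FX FY) => XY.
  exists Y => // y; rewrite in_cons => /orP[/eqP ->|/sX[Iy|/XY Yy]].
  - by right.
  - by left.
  - by right.
by exists X => // y; rewrite in_cons => /orP[/eqP ->|/sX //]; right; apply: XY.
Qed.

(** Exchange: if no element of the base [I'] could be added to [I], each of them
    would be expressed in [I], so that eliminating them turns the expression of
    any [y] in [I'] into one in [I], and [I] is maximal. Maximal extensions come from Zorn, since a
    finite support inside the union of a chain lies in one of its members. *)
Lemma indep_of_matroid : is_matroid indep_of.
Proof.
split.
- by move=> w _ w0 e; apply: suppPn => /w0.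
- by move=> I J JI iI w Ww wJ; apply: iI => //; apply: subset_trans wJ JI.
- move=> I I' iI nImax [iI' I'max]; apply: contrapT => nx.
  have {nx} uP x : exists w, (I' `\` I) x ->
      [/\ W w, w x = 1 & supp w `<=` I `|` [set x]].
    have [I'x|nI'x] := pselect ((I' `\` I) x); last by exists (fun=> 0).
    have [|w wP] := @dependent_vector I x iI; last by exists w.
    by move=> iIx; apply: nx; exists x.
  have [u {}uP] := choice uP.
  apply: nImax; split=> // Y iY IY; apply/seteqP; split=> // y Yy.
  apply: contrapT => nIy.
  have [I'y|nI'y] := pselect (I' y).
    have [Wuy uyy uyI] := uP y (conj I'y nIy).
    suff : u y y = 0 by rewrite uyy => /eqP; rewrite oner_eq0.
    by apply: iY => // x /uyI[/IY|->].
  have [|w [Ww wy wI']] := @dependent_vector I' y iI'.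
    move=> iI'y; apply: nI'y; rewrite -(I'max _ iI'y (@subsetUl _ _ _)).
    by right.
  have wI'y x : ~ (I `|` [set y]) x -> supp w x -> (I' `\` I) x.
    move=> nIyx wx; split; last by move=> Ix; apply: nIyx; left.
    by case: (wI' x wx) => // xy; case: nIyx; right.
  have [|w' [Ww' w'I w'd]] := @eliminate_outside (I `|` [set y]) u w _ Ww.
    move=> x nIyx wx; have [Wux uxx uxI] := uP x (wI'y x nIyx wx).
    by split=> // z /uxI[Iz|->]; [left; left|right].
  (* Testing against [d] shows that the elimination preserves the value at [y]. *)
  pose d x : k := `[< x = y >]%:R.
  have dE c : dot c d = c y.
    rewrite (@dot1 _ _ c d y) /d ?asboolT ?mulr1 // => x xy.
    by rewrite asboolF // mulr0.
  have : dot w' d = dot w d.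
    apply: w'd => x nIyx wx; rewrite dE; have [_ _ uI] := uP x (wI'y x nIyx wx).
    by apply: suppPn => /uI[//|yx]; case: nIyx; right.
  rewrite !dE wy (iY w') // => [/esym/eqP|x /w'I[/IY|->] //].
  by rewrite oner_eq0.
- move=> I X iI IX.
  (* The union with [I] makes the empty chain harmless. *)
  pose P J := indep_of (I `|` J) /\ J `<=` X.
  have [F FP Ftot|A [[iIA AX] Amax]] := @Zorn_bigcup _ P.
    split; last by move=> x [J /FP[_ JX] /JX].
    move=> w Ww wF; have [s sE] := (finite_seqP (T := {classic E}) _).1 (Wfin Ww).
    have sP x : x \in s -> supp w x by rewrite sE.
    have Ps x : supp w x -> (x : {classic E}) \in s by rewrite sE.
    have [sI|[J FJ sJ]] := @chain_cover I F s Ftot (fun x xs => wF x (sP x xs)).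
      by apply: iI => // x /Ps /sI.
    by apply: (FP _ FJ).1 => // x /Ps /sJ.
  exists (I `|` A); split=> [|Y [iY IY YX] IAY].
    by split=> [//||x [/IX|/AX] //]; apply: subsetUl.
  apply/seteqP; split=> // x Yx; apply: contrapT => nIAx.
  apply: (Amax Y); last first.
    by split=> //; rewrite (_ : I `|` Y = Y) //; apply/setUidPr.
  split; last by move=> YA; apply: nIAx; right; apply: YA.
  by move=> y Ay; apply: IAY; right.
Qed.

(** Let the base [B] meet [D] only in [e], and let the vector [u f] of [W] express
    [f] in [B], for each [f] outside [B]. The painting of [D] has value 1 at [e],
    value 0 on the rest of [B], and value [- u f e] at [f] outside [B]. It is orthogonal to every [u f], and every vector of [W] is
    reduced to zero by subtracting multiples of these. *)
Lemma indep_of_cocircuit D : cocircuits indep_of D ->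
  exists2 d, (forall w, W w -> orth w d) & supp d = D.
Proof.
move=> cD; have matM := indep_of_matroid.
have [e De] : exists e, D e by apply: circuit_nonempty cD; apply: dual_matroid.
have [B bB DB] := cocircuit_base cD De.
have Be : B e by have [] : (D `&` B) e by rewrite DB.
have uP f : exists w, ~ B f -> [/\ W w, w f = 1 & supp w `<=` B `|` [set f]].
  have [Bf|nBf] := pselect (B f); first by exists (fun=> 0).
  by have [w wP] := dependent_vector bB.1 (not_indep_add bB nBf); exists w.
have [u {}uP] := choice uP.
pose d f : k := if `[< B f >] then `[< f = e >]%:R else - u f e.
have dB f : B f -> f <> e -> d f = 0 by move=> Bf fe; rewrite /d asboolT // asboolF.
have de : d e = 1 by rewrite /d !asboolT.
have udot f : ~ B f -> dot (u f) d = 0.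
  move=> nBf; have [_ uff uB] := uP f nBf.
  have fe : f <> e by move=> fe; apply: nBf; rewrite fe.
  rewrite (@dot_widen _ _ ([set e] `|` [set f])) => [|x].
    rewrite fsbigU0 // ?fsbig_set1 //; last by move=> x [-> /esym].
    by rewrite de mulr1 uff mul1r /d asboolF //= subrr.
  move=> /not_orP[xe xf]; have [Bx|nBx] := pselect (B x); first by rewrite dB ?mulr0.
  by rewrite (suppPn (c := u f)) ?mul0r // => /uB[].
have Wd w : W w -> orth w d.
  move=> Ww; split.
    by apply: sub_finite_set (Wfin Ww) => x /=; apply: contra_neq => ->; rewrite mul0r.
  have [|w' [Ww' w'B w'd]] := @eliminate_outside B u w _ Ww.
    by move=> x nBx _; apply: uP.
  rewrite -w'd => [|x nBx _]; last exact: udot.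
  have w'0 := bB.1 w' Ww' w'B.
  by rewrite /dot fsbig1 // => x _; rewrite w'0 mul0r.
exists d => //; apply/esym.
apply: (fundamental_cocircuit_unique matM bB cD DB) => [|f C g [nC Cmin] _].
  apply/seteqP; split=> x; last by move=> ->; split=> //; rewrite /supp /= de oner_eq0.
  move=> [dx Bx]; apply: contrapT => xe.
  by move: dx; rewrite /supp /= dB ?eqxx.
move: nC => /existsNP[w /not_implyP[Ww /not_implyP[wC /existsNP[x wx]]]].
have wE : supp w = C by apply: Cmin => // /(_ w Ww (fun=> id) x).
by rewrite -wE; apply/orth_neq1/Wd.
Qed.

Lemma indep_of_painted : painted k indep_of.
Proof.
exists W, [set d | forall w, W w -> orth w d]; split=> [C [nC Cmin]|D cD|c d Wc].
- move: nC => /existsNP[w /not_implyP[Ww /not_implyP[wC /existsNP[x wx]]]].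
  by exists w => //; apply: Cmin => // /(_ w Ww (fun=> id) x).
- by have [d Wd dD] := indep_of_cocircuit cD; exists d.
- exact.
Qed.

End FiniteVectors.

(** * Walks in graphs *)

Lemma set2_eq (T : Type) (a b c d : T) : [set a; b] = [set c; d] ->
  (a = c /\ b = d) \/ (a = d /\ b = c).
Proof.
move=> abcd.
have [ac|ad] : [set c; d] a by rewrite -abcd; left.
  have [bc|bd] : [set c; d] b by rewrite -abcd; right.
    have [da|db] : [set a; b] d by rewrite abcd; right.
      by left; rewrite bc da ac.
    by left; rewrite db.
  by left.
have [bc|bd] : [set c; d] b by rewrite -abcd; right.
  by right.
have [ca|cb] : [set a; b] c by rewrite abcd; left.
  by right; rewrite ca bd ad.
by right; rewrite cb.
Qed.

Lemma set2_other (T : Type) (a b c : T) : [set a; b] = [set a; c] -> b = c.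
Proof. by move=> abac; case: (set2_eq abac) => [[_ //]|[ac ba]]; rewrite ba ac. Qed.

Lemma finite_minimal (T : Type) (P : set (set T)) F : finite_set F -> P F ->
  exists2 X, minimal_in P X & X `<=` F.
Proof.
move=> fF; have [s sF] := (finite_seqP (T := {classic T}) _).1 fF.
have {sF fF} : F `<=` [set` s] by rewrite sF.
have [n] := ubnP (size s); elim: n => // n IHn in s F *; rewrite ltnS => sn Fs PF.
have [Fmin|/not_andP[//|]] := pselect (minimal_in P F); first by exists F.
move=> /existsNP[Y /not_implyP[PY /not_implyP[YF nYF]]].
have [x Fx nYx] : exists2 x, F x & ~ Y x.
  apply: contrapT => /forall2NP FY; apply: nYF; apply/seteqP; split=> // x Fx.
  by case: (FY x) => // /contrapT.
have xs : (x : {classic T}) \in s by apply: Fs.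
have [||//|X Xmin XY] := IHn (filter (predC1 (x : {classic T})) s) Y.
- apply: leq_trans sn; rewrite size_filter -(count_predC (pred1 (x : {classic T}))).
  by rewrite -[ltnLHS]add0n ltn_add2r -has_count has_pred1.
- move=> y Yy; rewrite /= mem_filter /= (Fs y (YF y Yy)) andbT.
  by apply/eqP => yx; apply: nYx; rewrite -yx.
by exists X => //; apply: subset_trans YF.
Qed.

Section Walks.
Variable G : graph.
Implicit Types (Y F : set (edge G)) (S : set (vertex G)) (x y z : vertex G).

Lemma ends_sym (e : edge G) x y : ends e = [set x; y] -> ends e = [set y; x].
Proof. by move=> ->; rewrite setUC. Qed.

Lemma ends_at (e : edge G) x : ends e x -> exists y, ends e = [set x; y].
Proof.
have [u [v ->]] := endsP e; case=> ->; first by exists v.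
by exists u; rewrite setUC.
Qed.

(** A pair of an edge and one of its ends is the position of a walk that has just
    used this edge to reach this end. The next edge has to be a different one. *)
Definition step Y (p q : edge G * vertex G) : Prop :=
  [/\ Y q.1, q.1 <> p.1 & ends q.1 = [set p.2; q.2]].

(** Among the repetitions [v i = v j] of a two-way infinite walk, one with [j - i]
    minimal bounds a cycle. *)
Lemma walk_cycle_or_ray Y (v : int -> vertex G) (e : int -> edge G) :
    (forall i, Y (e i)) -> (forall i, ends (e i) = [set v i; v (i + 1)]) ->
    (forall i, e (i + 1) <> e i) ->
  exists2 F, cycle_edges F \/ double_ray_edges F & F `<=` Y.
Proof.
move=> Ye eE ered; have [vinj|nvinj] := pselect (injective v).
  exists (range e); last by move=> _ [i _ <-].
  by right; exists v, e.
have {nvinj} [n [i vi]] : exists n i, v i = v (i + n.+1%:Z).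
  apply: contrapT => nex; apply: nvinj => i j vij; apply: contrapT => ij.
  have [lij|lji] : (i < j) \/ (j < i) by lia.
    by apply: nex; exists `|j - i|.-1%N, i; rewrite vij; congr v; lia.
  by apply: nex; exists `|i - j|.-1%N, j; rewrite -vij; congr v; lia.
have exn : exists n, `[< exists i, v i = v (i + n.+1%:Z) >].
  by exists n; apply/asboolP; exists i.
have [{}n /asboolP[{}i {}vi] nmin] := ex_minnP exn.
have vinj (a b : int) : a < b -> b - a < n.+1%:Z -> v a <> v b.
  move=> ab ban vab; suff : (n <= `|b - a|.-1)%N by lia.
  by apply: nmin; apply/asboolP; exists a; rewrite vab; congr v; lia.
pose w (t : 'I_n.+1) := v (i + (t : nat)%:Z).
pose f (t : 'I_n.+1) := e (i + (t : nat)%:Z).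
have winj : injective w.
  move=> s t st; apply: val_inj => /=; apply: contrapT => nst.
  have [lst|lts] : (s < t)%N \/ (t < s)%N by lia.
    by move: st; apply: vinj; have := ltn_ord t; lia.
  by move/esym: st; apply: vinj; have := ltn_ord s; lia.
have fE t : ends (f t) = [set w t; w (ordS t)].
  rewrite /f eE; congr [set _; _].
  rewrite /w /=; have [tn|tn] : (t.+1 < n.+1)%N \/ t.+1 = n.+1 by have := ltn_ord t; lia.
    by rewrite modn_small //; congr v; lia.
  by rewrite tn modnn addr0 vi; congr v; lia.
exists (range f); last by move=> _ [t _ <-]; apply: Ye.
left; exists n, w, f; split=> //.
suff finj (s t : 'I_n.+1) : (s < t)%N -> f s <> f t.
  move=> s t st; apply: val_inj => /=; apply: contrapT => nst.
  have [/finj|/finj] : (s < t)%N \/ (t < s)%N by lia.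
    by apply.
  by apply.
move=> lst fst; have := fE s; rewrite fst fE => E2; case: (set2_eq E2) => [[/winj ts _]|[ts st]].
  by move: lst; rewrite ts ltnn.
move: ts st => /winj ts /winj st.
have ns : (s.+1 < n.+1)%N by have := ltn_ord t; lia.
have t1 : t = s.+1 :> nat by rewrite ts /= modn_small.
by apply: (ered (i + (s : nat)%:Z)); rewrite -[RHS]/(f s) fst /f t1; congr e; lia.
Qed.

Lemma two_sided_walk Y e x y (p q : nat -> edge G * vertex G) : Y e ->
    ends e = [set x; y] -> p 0%N = (e, y) -> q 0%N = (e, x) ->
    (forall n, step Y (p n) (p n.+1)) -> (forall n, step Y (q n) (q n.+1)) ->
  exists2 F, cycle_edges F \/ double_ray_edges F & F `<=` Y.
Proof.
move=> Ye exy p0 q0 pS qS.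
pose v (i : int) := match i with
  | Posz 0 => x | Posz n.+1 => (p n).2 | Negz n => (q n.+1).2 end.
pose f (i : int) := match i with Posz n => (p n).1 | Negz n => (q n.+1).1 end.
have fN n : f (- n%:Z) = (q n).1 by case: n => [|n] //=; rewrite p0 q0.
have vN n : v (- n%:Z) = (q n).2 by case: n => [|n] //=; rewrite q0.
have NS n : Negz n + 1 = - n%:Z by lia.
have PS n : Posz n + 1 = Posz n.+1 by lia.
apply: (@walk_cycle_or_ray Y v f) => [[[|n]|n]|[[|n]|n]|[n|n]].
- by rewrite /= p0.
- by have [] := pS n.
- by have [] := qS n.
- by rewrite PS /= p0.
- by rewrite PS /=; have [] := pS n.
- by rewrite NS vN /=; have [_ _ ->] := qS n; rewrite setUC.
- by rewrite PS /=; have [] := pS n.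
- by rewrite NS fN /= => qn; have [_] := qS n; rewrite qn.
Qed.

Lemma not_acc_walk Y p : ~ Acc (fun q p => step Y p q) p ->
  exists w : nat -> edge G * vertex G, w 0%N = p /\ forall n, step Y (w n) (w n.+1).
Proof.
pose NA p := ~ Acc (fun q p => step Y p q) p.
have next p' : exists q, NA p' -> step Y p' q /\ NA q.
  have [Ap|nAp] := pselect (NA p'); last by exists p'.
  apply: contrapT => nq; apply: Ap; split=> q pq; apply: contrapT => nA.
  by apply: nq; exists q.
have [h hP] := choice next => NAp.
have NAn n : NA (iter n h p) by elim: n => //= n /hP[].
by exists (fun n => iter n h p); split=> // n; have [] := hP _ (NAn n).
Qed.

Lemma acc_no_walk Y (I : Type) (p : I -> edge G * vertex G) (nx : I -> I) i :
  (forall i, step Y (p i) (p (nx i))) -> ~ Acc (fun q p => step Y p q) (p i).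
Proof.
move=> pS A; suff H q : Acc (fun q p => step Y p q) q -> forall j, p j <> q.
  by apply: (H _ A i).
by elim=> {}q _ IH j pq; apply: (IH (p (nx j)) _ (nx j)); rewrite // -pq.
Qed.

(** A walk in [F] never gets stuck, so it continues forever in both directions. *)
Lemma leafless_cycle_or_ray F e : F e ->
    (forall f u v, F f -> ends f = [set u; v] -> u <> v) ->
    (forall f u, F f -> ends f u -> exists f', [/\ F f', f' <> f & ends f' u]) ->
  exists2 F', cycle_edges F' \/ double_ray_edges F' & F' `<=` F.
Proof.
move=> Fe loopless leafless.
have walk f u : F f -> ends f u ->
    exists w : nat -> edge G * vertex G, w 0%N = (f, u) /\ forall n, step F (w n) (w n.+1).
  move=> Ff fu; apply: not_acc_walk => A.
  suff H p : Acc (fun q p => step F p q) p -> forall f u, F f -> ends f u -> (f, u) <> p.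
    exact: (H _ A f u).
  elim=> {}p _ IH {A}{}f {}u {}Ff {}fu pfu.
  have [f' [Ff' f'f f'u]] := leafless f u Ff fu.
  have [u' f'uu'] := ends_at f'u.
  apply: (IH (f', u') _ f' u') => //; first by rewrite -pfu.
  by rewrite f'uu'; right.
have [x [y exy]] := endsP e.
have [|q [q0 qS]] := walk e x Fe; first by rewrite exy; left.
have [|p [p0 pS]] := walk e y Fe; first by rewrite exy; right.
exact: two_sided_walk Fe exy p0 q0 pS qS.
Qed.

Lemma double_ray_edge_inj (v : int -> vertex G) (e : int -> edge G) :
    injective v -> (forall i, ends (e i) = [set v i; v (i + 1)]) -> injective e.
Proof.
move=> vinj eE i j eij; have := eE i; rewrite eij eE => E2.
by case: (set2_eq E2) => [[/vinj -> //]|[/vinj ji /vinj]]; lia.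
Qed.

Lemma double_ray_infinite F : double_ray_edges F -> ~ finite_set F.
Proof.
move=> [v [e [vinj eE ->]]] fF; have einj := double_ray_edge_inj vinj eE.
apply: infinite_nat.
have -> : [set: nat] = (fun n : nat => e n) @^-1` range e.
  by apply/seteqP; split=> n // _; exists n.
by apply: finite_preimage fF => m n _ _ /einj [].
Qed.

Lemma cycle_finite F : cycle_edges F -> finite_set F.
Proof. by move=> [n [v [e [_ _ _ ->]]]]; apply: finite_image; apply: finite_finset. Qed.

(** ** Connectedness *)

Inductive conn Y x : vertex G -> Prop :=
| conn0 : conn Y x x
| connS z z' f : conn Y x z -> Y f -> ends f = [set z; z'] -> conn Y x z'.

Lemma conn_trans Y x y z : conn Y x y -> conn Y y z -> conn Y x z.
Proof. by move=> xy; elim=> // a b f _ xa Yf fE; apply: connS xa Yf fE. Qed.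

Lemma conn_edge Y f x y : Y f -> ends f = [set x; y] -> conn Y x y.
Proof. by move=> Yf fE; apply: connS (conn0 _ _) Yf fE. Qed.

Lemma conn_sym Y x y : conn Y x y -> conn Y y x.
Proof.
elim=> [|a b f _ ax Yf fE]; first exact: conn0.
by apply: conn_trans ax; apply: conn_edge Yf _; rewrite fE setUC.
Qed.

Lemma connW Y Y' x y : Y `<=` Y' -> conn Y x y -> conn Y' x y.
Proof. by move=> YY'; elim=> [|a b f _ xa /YY' Yf fE]; [apply: conn0|apply: connS xa Yf fE]. Qed.

(** ** Cuts *)

Definition cut_of S : set (edge G) :=
  [set e | ends e `&` S !=set0 /\ ends e `&` ~` S !=set0].

Lemma cut_ofP S e u v : ends e = [set u; v] -> cut_of S e <-> ~ (S u <-> S v).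
Proof.
move=> eE; rewrite /cut_of /= eE; split.
  by move=> [[a [[->|->] Sa]] [b [[->|->] /= Sb]]]; tauto.
move=> uv; have [Su|nSu] := pselect (S u); have [Sv|nSv] := pselect (S v); try tauto.
  by split; [exists u; split=> //; left|exists v; split=> //; right].
by split; [exists v; split=> //; right|exists u; split=> //; left].
Qed.

Lemma conn_cut Y x f : Y f -> ~ cut_of (conn Y x) f.
Proof.
move=> Yf; have [u [v fE]] := endsP f; rewrite (cut_ofP _ fE); apply.
by split=> xu; [apply: connS xu Yf fE|apply: connS xu Yf (ends_sym fE)].
Qed.

End Walks.

(** * Flows and potentials *)

Section Flows.
Variables (k : fieldType) (G : graph).
Implicit Types (Y F : set (edge G)) (S : set (vertex G)) (x y z : vertex G).
Implicit Types (c w : edge G -> k) (g : vertex G -> k).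

Lemma ends_pair (e : edge G) : exists p, ends e = [set p.1; p.2].
Proof. by have [u [v]] := endsP e; exists (u, v). Qed.

(** An arbitrary orientation of the edges. *)
Definition tail (e : edge G) := (sval (cid (ends_pair e))).1.
Definition head (e : edge G) := (sval (cid (ends_pair e))).2.

Lemma ends_tail_head e : ends e = [set tail e; head e].
Proof. by rewrite /tail /head; case: cid. Qed.

(** The coboundary of the potential [g]. *)
Definition delta g (e : edge G) : k := g (head e) - g (tail e).

Definition ind S x : k := `[< S x >]%:R.

Lemma supp_delta_ind S : supp (delta (ind S)) = cut_of S.
Proof.
apply/seteqP; split=> e; rewrite (cut_ofP S (ends_tail_head e)) /supp /delta /ind /=.
  move=> + he; have -> : `[< S (head e) >] = `[< S (tail e) >].
    by apply/asbool_equiv_eq; split=> [/he|/he].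
  by rewrite subrr eqxx.
have [Sh|nSh] := pselect (S (head e)); have [St|nSt] := pselect (S (tail e)); try tauto.
  by rewrite asboolT // asboolF // subr0 oner_eq0.
by rewrite asboolF // asboolT // sub0r oppr_eq0 oner_eq0.
Qed.

(** The edges [e i], taken as directed from [v i] to [w i]. *)
Lemma directed_edges (I : Type) (v w : I -> vertex G) (e : I -> edge G) :
    injective e -> (forall i, ends (e i) = [set v i; w i]) ->
  exists c, supp c = range e /\
    forall i g, c (e i) * delta g (e i) = g (w i) - g (v i).
Proof.
move=> einj eE.
have cP f : exists a : k, (range e f <-> a != 0) /\
    forall i g, e i = f -> a * delta g f = g (w i) - g (v i).
  have [[i _ eif]|nf] := pselect (range e f); last first.
    exists 0; split; first by rewrite eqxx; split.
    by move=> i g eif; case: nf; exists i.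
  have := eE i; rewrite eif ends_tail_head => thE.
  have sg (a : k) : a != 0 -> (range e f <-> a != 0).
    by move=> a0; split=> // _; exists i.
  case: (set2_eq thE) => -[tE hE].
    exists 1; split; first exact/sg/oner_neq0.
    by move=> j g ejf; rewrite mul1r /delta tE hE (einj j i) // eif.
  exists (-1); split; first by apply: sg; rewrite oppr_eq0 oner_eq0.
  by move=> j g ejf; rewrite mulN1r /delta tE hE (einj j i) ?eif // opprB.
have [c {}cP] := choice cP.
exists c; split; last by move=> i g; apply: (cP (e i)).2.
by apply/seteqP; split=> f; rewrite /supp /= => /(cP f).1.
Qed.

(** Conservation at the vertices is tested against all potentials. The potential
    concentrated in a vertex gives the condition at this vertex. *)
Definition flow : set (edge G -> k) :=
  [set c | finite_set (supp c) /\ forall g, dot c (delta g) = 0].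

Lemma flow_finite c : flow c -> finite_set (supp c).
Proof. by case. Qed.

Lemma flow_orth c g : flow c -> orth c (delta g).
Proof.
move=> [fc c0]; split=> //; apply: sub_finite_set fc => e /=.
by apply: contra_neq => ->; rewrite mul0r.
Qed.

Lemma supp_subBZ a c c' : supp (fun e => c e - a * c' e) `<=` supp c `|` supp c'.
Proof.
move=> e he; apply: contrapT => /not_orP[nce nc'e]; move: he.
by rewrite /supp /= (suppPn nce) (suppPn nc'e) mulr0 subr0 eqxx.
Qed.

Lemma flowBZ a c c' : flow c -> flow c' -> flow (fun e => c e - a * c' e).
Proof.
move=> [fc c0] [fc' c'0]; split=> [|g]; last by rewrite dotBZ // c0 c'0 mulr0 subr0.
by apply: (sub_finite_set (@supp_subBZ a c c')); rewrite finite_setU.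
Qed.

Lemma sum_directed (I : choiceType) (v w : I -> vertex G) (e : I -> edge G) c g :
    injective e -> supp c = range e ->
    (forall i, c (e i) * delta g (e i) = g (w i) - g (v i)) ->
  dot c (delta g) = \sum_(i \in [set: I]) (g (w i) - g (v i)).
Proof.
move=> einj ce cE; rewrite (@dot_widen _ _ (range e)); last first.
  by move=> f nf; rewrite (suppPn (c := c)) ?mul0r // ce.
rewrite (@fsbig_image _ _ _ I {classic edge G} setT e); last by move=> i j _ _ /einj.
by apply: eq_fsbigr => i _; rewrite cE.
Qed.

Lemma cycle_flow F : cycle_edges F -> exists2 c, flow c & supp c = F.
Proof.
move=> [n [v [e [vinj einj eE ->]]]].
have [c [ce cE]] := directed_edges einj eE.
exists c => //; split=> [|g]; first by rewrite ce; apply: finite_image; apply: finite_finset.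
rewrite (sum_directed einj ce (cE ^~ g)).
rewrite (fsbigE (index_enum 'I_n.+1)) ?index_enum_uniq //; last first.
  by move=> i _; rewrite mem_index_enum.
rewrite big_split /= sumrN; apply/eqP; rewrite subr_eq0; apply/eqP/esym.
exact: (reindex_inj (@ordS_inj n.+1)).
Qed.

(** Sending one unit along a walk from [x] to [y] gives [c]. *)
Lemma conn_chain Y x y : conn Y x y -> exists c,
  [/\ finite_set (supp c), supp c `<=` Y & forall g, dot c (delta g) = g y - g x].
Proof.
elim=> [|z z' f _ [c [fc cY cg]] Yf fE].
  have s0 : supp (fun _ : edge G => 0 : k) = set0.
    by apply/seteqP; split=> e; rewrite /supp /= ?eqxx.
  exists (fun=> 0); split=> [||g]; rewrite ?s0 //.
  by rewrite subrr /dot fsbig1 // => e _; rewrite mul0r.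
have [c' [c'f c'E]] := @directed_edges unit (fun=> z') (fun=> z) (fun=> f)
  (fun a b _ => match a, b with tt, tt => erefl end) (fun=> ends_sym fE).
have {}c'f : supp c' = [set f] by rewrite c'f; apply/seteqP; split=> [_ [_ _ <-]|_ ->] //; exists tt.
have fc' : finite_set (supp c') by rewrite c'f.
exists (fun e => c e - 1 * c' e); split=> [||g].
- by apply: (sub_finite_set (@supp_subBZ 1 c c')); rewrite finite_setU.
- by move=> e /supp_subBZ[/cY //|]; rewrite c'f => ->.
- rewrite dotBZ // cg mul1r (dot1 (e := f)) => [|e ef].
    by rewrite (c'E tt g) opprB addrC addrA subrK.
  by rewrite (suppPn (c := c')) ?mul0r // c'f.
Qed.

Lemma conn_flow Y f x y : conn Y x y -> ends f = [set x; y] -> ~ Y f ->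
  exists w, [/\ flow w, supp w `<=` Y `|` [set f] & w f != 0].
Proof.
move=> xy fE nYf; have [c [fc cY cg]] := conn_chain xy.
have [c' [c'f c'E]] := @directed_edges unit (fun=> x) (fun=> y) (fun=> f)
  (fun a b _ => match a, b with tt, tt => erefl end) (fun=> fE).
have {}c'f : supp c' = [set f] by rewrite c'f; apply/seteqP; split=> [_ [_ _ <-]|_ ->] //; exists tt.
have fc' : finite_set (supp c') by rewrite c'f.
exists (fun e => c e - 1 * c' e); split.
- split=> [|g].
    by apply: (sub_finite_set (@supp_subBZ 1 c c')); rewrite finite_setU.
  rewrite dotBZ // cg mul1r (dot1 (e := f)) => [|e ef].
    by rewrite (c'E tt g) subrr.
  by rewrite (suppPn (c := c')) ?mul0r // c'f.
- by move=> e /supp_subBZ[/cY|]; [left|rewrite c'f; right].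
- rewrite (suppPn (c := c)); last by move=> /cY.
  by rewrite sub0r mul1r oppr_eq0; have : supp c' f by rewrite c'f.
Qed.

(** If [e] were the only edge of the support of [w] at its end [u], then [w]
    would not be orthogonal to the potential concentrated in [u]. *)
Lemma flow_leafless w e u : flow w -> supp w e -> (forall x, ends e <> [set x; x]) ->
  ends e u -> exists e', [/\ supp w e', e' <> e & ends e' u].
Proof.
move=> [_ w0] we nloop /ends_at[v eE]; apply: contrapT => ne'.
have : w e * delta (ind [set u]) e != 0.
  rewrite mulf_neq0 //; suff : supp (delta (ind [set u])) e by [].
  rewrite supp_delta_ind (cut_ofP _ eE) => -[/(_ erefl) vu _].
  by apply: (nloop u); rewrite eE vu.
rewrite -(dot1 (e := e)) ?w0 ?eqxx // => e' e'e.
have [we'|nwe'] := pselect (supp w e'); last by rewrite (suppPn nwe') mul0r.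
rewrite (suppPn (c := delta _)) ?mulr0 // supp_delta_ind => -[[z [e'z zu]] _].
by apply: ne'; exists e'; split=> //; rewrite -zu.
Qed.

Lemma flow_supp_cycle w e : flow w -> supp w e ->
  exists2 F, cycle_edges F & F `<=` supp w.
Proof.
move=> fw we.
have [[f [wf [x fE]]]|nloop] := pselect (exists f, supp w f /\ exists x, ends f = [set x; x]).
  exists [set f]; last by move=> _ ->.
  exists 0%N, (fun=> x), (fun=> f); split=> //.
  - by move=> i j _; rewrite !ord1.
  - by move=> i j _; rewrite !ord1.
  - by apply/seteqP; split=> [_ ->|_ [_ _ <-]] //; exists ord0.
have [||F [cF|rF] Fw] := @leafless_cycle_or_ray _ (supp w) e we.
- by move=> f u v wf fE uv; apply: nloop; exists f; split=> //; exists u; rewrite fE uv.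
- move=> f u wf; apply: flow_leafless => // x fE.
  by apply: nloop; exists f; split=> //; exists x.
- by exists F.
- by case: (double_ray_infinite rF); apply: sub_finite_set Fw (flow_finite fw).
Qed.

(** A flow through [f] with minimal support has a cycle as support: a cycle in this
    support that avoided [f] could be used to shrink it. *)
Lemma flow_cycle w f : flow w -> supp w f -> exists F,
  [/\ cycle_edges F, F f, F `<=` supp w &
      forall F', cycle_edges F' -> F' `<=` F -> F' = F].
Proof.
move=> fw wf.
have [] := @finite_minimal _ [set X | exists c, [/\ flow c, supp c f & supp c = X]] _
   (flow_finite fw); first by exists w.
move=> _ [[c [fc cf <-]] cmin] cw.
have cyc F : cycle_edges F -> F `<=` supp c -> F = supp c.
  move=> cF Fc; have [c' fc' c'F] := cycle_flow cF.
  have [Ff|nFf] := pselect (F f); first by apply: cmin => //; exists c'; rewrite c'F.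
  have [e Fe] : exists e, F e.
    by move: cF => [n [v [e [_ _ _ ->]]]]; exists (e ord0); exists ord0.
  have c'e : c' e != 0 by have : supp c' e by rewrite c'F.
  pose a := c e / c' e; pose d e' := c e' - a * c' e'.
  have dc : supp d `<=` supp c by move=> x /supp_subBZ[//|]; rewrite c'F => /Fc.
  have df : supp d f.
    by rewrite /supp /= /d (suppPn (c := c')) ?c'F // mulr0 subr0.
  have dE : supp d = supp c by apply: cmin => //; exists d; split=> //; apply: flowBZ.
  have : supp d e by rewrite dE; apply: Fc.
  by rewrite /supp /= /d /a divfK // subrr eqxx.
have [F cF Fc] := flow_supp_cycle fc cf.
exists F; split=> //; first by rewrite (cyc F).
- exact: subset_trans Fc cw.
- move=> F' cF' F'F; rewrite (cyc F) //; apply: cyc => //.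
  exact: subset_trans F'F Fc.
Qed.

(** * The finite cycle matroid, the bond matroid and their relatives *)

Lemma M_FC_indep_of : M_FC G = indep_of flow.
Proof.
apply/seteqP; split=> I iI.
  move=> w fw wI e; apply: contrapT => /eqP we.
  have [F cF Fw] := flow_supp_cycle fw we.
  by apply: (iI F cF); apply: subset_trans wI.
move=> F cF FI; have [c fc cF'] := cycle_flow cF.
have [e Fe] : exists e, F e.
  by move: cF => [n [v [e [_ _ _ ->]]]]; exists (e ord0); exists ord0.
have : supp c e by rewrite cF'.
by rewrite /supp /= (iI c) ?eqxx // cF'.
Qed.

Lemma M_FC_matroid : is_matroid (M_FC G).
Proof. by rewrite M_FC_indep_of; apply: indep_of_matroid; [apply: flow_finite|apply: flowBZ]. Qed.

Lemma M_FC_painted : painted k (M_FC G).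
Proof. by rewrite M_FC_indep_of; apply: indep_of_painted; [apply: flow_finite|apply: flowBZ]. Qed.

Definition finite_coboundary : set (edge G -> k) :=
  [set c | finite_set (supp c) /\ exists g, c = delta g].

Lemma finite_coboundary_finite c : finite_coboundary c -> finite_set (supp c).
Proof. by case. Qed.

Lemma finite_coboundaryBZ a c c' : finite_coboundary c -> finite_coboundary c' ->
  finite_coboundary (fun e => c e - a * c' e).
Proof.
move=> [fc [g cE]] [fc' [g' c'E]]; split.
  by apply: (sub_finite_set (@supp_subBZ a c c')); rewrite finite_setU.
exists (fun x => g x - a * g' x); apply/funext => e; rewrite cE c'E /delta.
by rewrite mulrBr !opprD !opprK addrACA.
Qed.

Lemma cutE F : cut F <-> exists S, F = cut_of S.
Proof. by []. Qed.

(** The level set of a potential through one end of an edge in the support of its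
    coboundary defines a cut inside this support. *)
Lemma M_FB_indep_of : M_FB G = indep_of finite_coboundary.
Proof.
apply/seteqP; split=> I iI.
  move=> c [fc [g cE]] cI e; apply: contrapT => /eqP ce.
  pose S := [set x | g x = g (head e)].
  have Sc : cut_of S `<=` supp c.
    move=> f; rewrite (cut_ofP S (ends_tail_head f)) /S /= => fS.
    rewrite /supp /= cE /delta subr_eq0; apply/eqP => ghf; apply: fS.
    by rewrite ghf.
  have [||X Xbond XS] := @finite_minimal _ [set F | cut F /\ F !=set0] (cut_of S).
  - exact: sub_finite_set fc.
  - split; first by exists S.
    exists e; rewrite (cut_ofP S (ends_tail_head e)) /S /= => -[_ /(_ erefl)].
    by move: ce; rewrite cE /delta => /eqP + gt; apply; rewrite gt subrr.
  have Xc := subset_trans XS Sc.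
  by apply: (iI X); [split=> //; apply: sub_finite_set fc|apply: subset_trans cI].
move=> F [[[/cutE[S FE] [e Fe]] _] fF] FI.
have : supp (delta (ind S)) e by rewrite supp_delta_ind -FE.
rewrite /supp /= iI ?eqxx //; last by rewrite supp_delta_ind -FE.
by split; [rewrite supp_delta_ind -FE|exists (ind S)].
Qed.

Lemma M_FB_matroid : is_matroid (M_FB G).
Proof.
by rewrite M_FB_indep_of; apply: indep_of_matroid;
  [apply: finite_coboundary_finite|apply: finite_coboundaryBZ].
Qed.

Lemma M_FB_painted : painted k (M_FB G).
Proof.
by rewrite M_FB_indep_of; apply: indep_of_painted;
  [apply: finite_coboundary_finite|apply: finite_coboundaryBZ].
Qed.

(** An edge of the cut outside the base would lie on a cycle that meets the cut
    nowhere else. *)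
Lemma cut_codependent S e : cut_of S e -> ~ dual (M_FC G) (cut_of S).
Proof.
move=> Se [B bB SB]; have nBe := SB e Se.
have bB' := bB; rewrite M_FC_indep_of in bB'.
have [w [fw we wB]] := dependent_vector flowBZ bB'.1 (not_indep_add bB' nBe).
apply: (@orth_neq1 _ _ w (delta (ind S)) e (flow_orth _ fw)).
rewrite supp_delta_ind; apply/seteqP; split=> x.
  by move=> [/wB[Bx|//] /SB].
by move=> ->; split=> //; rewrite /supp /= we oner_eq0.
Qed.

(** A cocircuit [D] meets no cycle in exactly one edge, so the vertices that can be
    reached from one end of an edge of [D] without using [D] define a cut inside
    [D]. *)
Lemma cocircuit_bond D : cocircuits (M_FC G) D -> bond D.
Proof.
move=> cD; have [CC [DD [cC cD' orthCD]]] := M_FC_painted.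
have [e De] : exists e, D e by apply: circuit_nonempty cD; apply/dual_matroid/M_FC_matroid.
pose S := conn (~` D) (tail e).
have SD : cut_of S `<=` D.
  by move=> f Sf; apply: contrapT => nDf; apply: (conn_cut (Y := ~` D)) Sf.
have Se : cut_of S e.
  rewrite (cut_ofP S (ends_tail_head e)) => -[/(_ (conn0 _ _)) Sh _].
  have [|w [fw wD we]] := conn_flow Sh (ends_tail_head e); first by apply.
  have [F [cF Fe Fw Fmin]] := flow_cycle fw we.
  have FC : circuits (M_FC G) F.
    split=> [iF|Y /existsNP[F' /not_implyP[cF' /contrapT F'Y]] YF]; first exact: (iF F).
    have F'F : F' = F by apply: Fmin => //; apply: subset_trans YF.
    by apply/seteqP; split=> //; rewrite -F'F.
  apply: (circuit_cocircuit_neq1 M_FC_matroid FC cD (e := e)).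
  by apply/seteqP; split=> x; [move=> [/Fw/wD[]//]|move=> ->].
have cuts F : cut F /\ F !=set0 -> F `<=` D -> F = D.
  move=> [/cutE[T ->] [f Tf]] TD; apply: cD.2 => //.
  exact: cut_codependent Tf.
have DE : cut_of S = D by apply: cuts => //; split; [exists S|exists e].
by split; first by split; [exists S; rewrite -DE|exists e].
Qed.

Lemma M_B_dual : M_B G = dual (M_FC G).
Proof.
apply/seteqP; split=> I.
  move=> iI; apply: contrapT => /(dependent_circuit (dual_matroid M_FC_matroid))[D cD].
  exact/iI/cocircuit_bond.
move=> iI D [[/cutE[S ->] [e Se]] _] SI; apply: (cut_codependent Se).
by apply: (indepS (dual_matroid M_FC_matroid)) SI iI.
Qed.

End Flows.

(** * Rayless trees and double rays *)

Section Rays.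
Variable G : graph.
Implicit Types (Y F : set (edge G)) (S : set (vertex G)) (x y z : vertex G).
Implicit Types (v : int -> vertex G) (e : int -> edge G).

Definition is_double_ray v e := injective v /\ forall i, ends (e i) = [set v i; v (i + 1)].

Lemma ray_rev v e : is_double_ray v e -> is_double_ray (fun i => v (- i)) (fun i => e (- i - 1)).
Proof.
move=> [vinj eE]; split=> [i j /vinj|i]; first by lia.
by rewrite eE setUC; congr [set _; _]; congr v; lia.
Qed.

Lemma ray_rev_range v e : range (fun i => e (- i - 1)) = range e.
Proof.
apply/seteqP; split=> _ [i _ <-]; first by exists (- i - 1).
by exists (- i - 1) => //; congr e; lia.
Qed.

Lemma ray_rev_vrange v : range (fun i => v (- i)) = range v.
Proof.
apply/seteqP; split=> _ [i _ <-]; first by exists (- i).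
by exists (- i) => //; rewrite opprK.
Qed.

Lemma ray_edge_inj v e : is_double_ray v e -> injective e.
Proof. by move=> [vinj eE]; apply: double_ray_edge_inj eE. Qed.

(** No infinite walk in [Y] starts in [S]. Since walks never turn back, this
    excludes cycles other than loops as well as rays. *)
Definition rayless Y S := forall a g, S a -> Acc (fun q p => step Y p q) (g, a).

(** A walk from [a] either goes back along the first edge of the path to [x], or
    it is part of a walk that enters [a] from the side of [x]. *)
Lemma rayless_conn Y (e : edge G) x : Acc (fun q p => step Y p q) (e, x) -> ~ Y e ->
  rayless Y (conn Y x).
Proof.
move=> Ax nYe a + xa; elim: xa => [|z z' f _ IH Yf fE] g; split=> -[h u] [/= Yh hg hE].
  by apply: (Acc_inv Ax); split=> //= he; apply: nYe; rewrite -he.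
have [hf|hf] := pselect (h = f).
  have -> : u = z; last exact: IH.
  by apply: (@set2_other _ z'); rewrite -hE hf fE setUC.
have Af : Acc (fun q p => step Y p q) (f, z').
  by apply: (Acc_inv (IH e)); split=> //= fe; apply: nYe; rewrite -fe.
by apply: (Acc_inv Af); split.
Qed.

(** The edges [f1] and [f2] occur at most once on the double ray, so they can be
    left behind. *)
Lemma rayless_no_tail Y S v e f1 f2 m : is_double_ray v e -> rayless Y S ->
    (forall i, S (v i) -> S (v (i + 1)) -> [\/ Y (e i), e i = f1 | e i = f2]) ->
    (forall i, m <= i -> S (v i)) \/ (forall i, i <= m -> S (v i)) ->
  False.
Proof.
suff up v' e' m' : is_double_ray v' e' -> rayless Y S ->
    (forall i, S (v' i) -> S (v' (i + 1)) -> [\/ Y (e' i), e' i = f1 | e' i = f2]) ->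
    (forall i, m' <= i -> S (v' i)) -> False.
  move=> vray rl eY [mS|mS]; first exact: (up _ _ _ vray rl eY mS).
  apply: (up _ _ (- m) (ray_rev vray) rl) => i.
    move=> Si Si1; apply: eY; first by move: Si1; congr (S (v _)); lia.
    by move: Si; congr (S (v _)); lia.
  by move=> mi; apply: mS; lia.
move=> vray rl eY mS; have einj := ray_edge_inj vray; have [vinj eE] := vray.
have bound f : exists b, forall i, b <= i -> e' i <> f.
  have [[j <-]|nf] := pselect (exists j, e' j = f); last first.
    by exists 0 => i _ eif; apply: nf; exists i.
  by exists (j + 1) => i + /einj; lia.
have [b1 b1P] := bound f1; have [b2 b2P] := bound f2.
have [n [n1 n2 nm]] : exists n, [/\ b1 <= n, b2 <= n & m' <= n].
  by exists (`|b1| + `|b2| + `|m'|); split; lia.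
have nY i : n <= i -> Y (e' i).
  move=> ni; case: (eY i); try by apply: mS; lia.
  - by [].
  - by move/b1P: (le_trans n1 ni).
  - by move/b2P: (le_trans n2 ni).
pose p (i : nat) := (e' (n + i%:Z), v' (n + i%:Z + 1)).
apply: (@acc_no_walk _ Y nat p succn 0%N) => [i|].
  split=> /=; first by apply: nY; lia.
    by move=> /einj; lia.
  by rewrite eE; congr [set v' _; v' _]; lia.
by apply: rl; apply: mS; lia.
Qed.

Lemma rayless_no_cycle Y S n (w : 'I_n.+1 -> vertex G) (f : 'I_n.+1 -> edge G) i :
    injective f -> (forall j, ends (f j) = [set w j; w (ordS j)]) ->
    (forall g z, Y g -> ends g <> [set z; z]) -> rayless Y S -> S (w i) ->
    (forall j, S (w j) -> Y (f j) /\ S (w (ordS j))) ->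
  False.
Proof.
move=> finj fE loopless rl Si Sj.
pose t m := iter m (@ordS n.+1) i.
have St m : S (w (t m)) by elim: m => //= m /Sj[].
pose p m := (f (t m), w (t m.+1)).
apply: (@acc_no_walk _ Y nat p succn 0%N) => [m|]; last exact/rl/(St 1%N).
split=> /=; first by have [] := Sj _ (St m.+1).
  move=> /finj tt; have [Yf _] := Sj _ (St m).
  by apply: (loopless _ (w (t m)) Yf); rewrite fE; congr [set _; w _].
by rewrite fE.
Qed.

Lemma ray_side v e S i0 j : is_double_ray v e -> (forall i, cut_of S (e i) -> i = i0) ->
  S (v j) -> exists m, (forall i, m <= i -> S (v i)) \/ (forall i, i <= m -> S (v i)).
Proof.
move=> [vinj eE] cut1 Sj; exists j.
have noc i : i <> i0 -> (S (v i) <-> S (v (i + 1))).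
  move=> ii0; apply: contrapT => nS; apply: ii0; apply: cut1.
  by rewrite (cut_ofP _ (eE i)).
have [ji|ij] : i0 < j \/ j <= i0 by lia.
  left=> i ij; have -> : i = j + `|i - j|%:Z by lia.
  elim: `|i - j|%N => [|n IHn]; first by rewrite addr0.
  have -> : j + n.+1%:Z = j + n%:Z + 1 by lia.
  by apply: (noc (j + n%:Z) _).1 IHn; lia.
right=> i ji; have -> : i = j - `|i - j|%:Z by lia.
elim: `|i - j|%N => [|n IHn]; first by rewrite subr0.
apply: (noc (j - n.+1%:Z) _).2; first by lia.
by have -> : j - n.+1%:Z + 1 = j - n%:Z by lia.
Qed.

Lemma int_unbounded (P : set int) : infinite_set P ->
  (forall n, exists2 i, n <= i & P i) \/ (forall n, exists2 i, i <= n & P i).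
Proof.
move=> Pinf; apply: contrapT => /not_orP[/existsNP[b nb] /existsNP[a na]].
apply: Pinf; apply: (@sub_finite_set _ _ ((fun n : nat => a + n%:Z) @` `I_(`|b - a|.+1))).
  move=> i Pi; exists `|i - a|%N => /=.
    have : ~ b <= i by move=> bi; apply: nb; exists i.
    have : ~ i <= a by move=> ia; apply: na; exists i.
    by lia.
  have : ~ i <= a by move=> ia; apply: na; exists i.
  by lia.
by apply: finite_image; apply: finite_II.
Qed.

End Rays.

Lemma finite_subsingleton (T : Type) (P : set T) :
  (forall x y, P x -> P y -> x = y) -> finite_set P.
Proof.
move=> Puniq; have [[x Px]|nP] := pselect (exists x, P x).
  by apply: (@sub_finite_set _ _ [set x]) => // y /Puniq; apply.
apply: (@sub_finite_set _ _ set0) => // y Py; by apply: nP; exists y.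
Qed.

(** * The algebraic cycle matroid *)

Section AlgebraicCycles.
Variables (k : fieldType) (G : graph).
Hypothesis matA : is_matroid (M_A G).
Implicit Types (B C D Y F : set (edge G)) (S : set (vertex G)) (x y z : vertex G).
Implicit Types (v : int -> vertex G) (e : int -> edge G).

Lemma M_A_circuit C : circuits (M_A G) C -> cycle_edges C \/ double_ray_edges C.
Proof.
move=> [/existsNP[F /not_implyP[cF /contrapT FC]] Cmin].
by have <- : F = C by apply: Cmin => // iF; apply: (iF F cF).
Qed.

(** A walk from [x] to [y] in [Y - f] would close up with [f] to a flow. *)
Lemma M_A_acyclic Y f x y : M_A G Y -> Y f -> ends f = [set x; y] ->
  ~ conn (Y `\ f) x y.
Proof.
move=> iY Yf fE xy; have [|w [fw wY wf]] := conn_flow k xy fE.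
  by move=> [_ /(_ erefl)].
have [F cF Fw] := flow_supp_cycle fw wf.
apply: (iY F); first by left.
by move=> z /Fw/wY[[]|->].
Qed.

Lemma M_A_loopless Y f x : M_A G Y -> Y f -> ends f <> [set x; x].
Proof. by move=> iY Yf fE; apply: (M_A_acyclic iY Yf fE); apply: conn0. Qed.

(** Let [D] be the fundamental cocircuit of [e] with respect to a base [B]. One of
    the two components into which [e] splits its component of [B] is rayless, and
    [D] is the cut around the vertex set of this component. *)
Lemma M_A_cocircuit D : cocircuits (M_A G) D -> exists Y g x,
  [/\ M_A G Y, ~ Y g, rayless Y (conn Y x) & D = cut_of (conn Y x)].
Proof.
move=> cD; have [e De] : exists e : edge G, D e.
  by apply: circuit_nonempty cD; apply: dual_matroid.
have [B bB DB] := cocircuit_base cD De.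
have [_ Be] : (D `&` B) e by rewrite DB.
pose Y := B `\ e.
have [x [y [exy Ax]]] : exists x y, ends e = [set x; y] /\
    Acc (fun q p => step Y p q) (e, x).
  have [x [y exy]] := endsP e; apply: contrapT => nA.
  have [q [q0 qS]] : exists q : nat -> _, q 0%N = (e, x) /\ forall n, step Y (q n) (q n.+1).
    by apply: not_acc_walk => Ax; apply: nA; exists x, y.
  have [p [p0 pS]] : exists q : nat -> _, q 0%N = (e, y) /\ forall n, step Y (q n) (q n.+1).
    by apply: not_acc_walk => Ay; apply: nA; exists y, x; rewrite (ends_sym exy).
  have stepB p1 p2 : step Y p1 p2 -> step B p1 p2 by case=> -[].
  have [F cF FB] := two_sided_walk Be exy p0 q0 (fun n => stepB _ _ (pS n))
    (fun n => stepB _ _ (qS n)).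
  exact: (bB.1 F cF).
have nYe : ~ Y e by move=> [_ /(_ erefl)].
have rl := rayless_conn Ax nYe.
exists Y, e, x; split=> //; first by apply: (indepS matA _ bB.1) => z [].
set S := conn Y x.
have Se : cut_of S e.
  rewrite (cut_ofP S exy) => -[/(_ (conn0 _ _)) Sy _].
  exact: M_A_acyclic bB.1 Be exy Sy.
apply: (fundamental_cocircuit_unique matA bB cD DB) => [|f C g cC CB CS].
  apply/seteqP; split=> f; last by move=> ->.
  by move=> [Sf Bf]; apply: contrapT => fe; apply: (conn_cut (Y := Y)) Sf.
case: (M_A_circuit cC) => [cycC|[v [e' [vinj eE CE]]]].
  have [c fc cE] := cycle_flow k cycC.
  by apply: (orth_neq1 (flow_orth (ind k S) fc) (e := g)); rewrite cE supp_delta_ind.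
have vray : is_double_ray v e' by [].
have [Cg Sg] : (C `&` cut_of S) g by rewrite CS.
rewrite CE in Cg; case: Cg => i0 _ gE.
have cut1 i : cut_of S (e' i) -> i = i0.
  move=> Si; apply: (ray_edge_inj vray); rewrite gE.
  have : (C `&` cut_of S) (e' i) by split=> //; rewrite CE; exists i.
  by rewrite CS.
have [j Sj] : exists j, S (v j).
  apply: contrapT => nS; move: Sg; rewrite -gE (cut_ofP _ (eE i0)); apply.
  by split=> Sv; case: nS; [exists i0|exists (i0 + 1)].
have [m mS] := ray_side vray cut1 Sj.
apply: (rayless_no_tail (f1 := e) (f2 := f) vray rl _ mS) => i _ _.
have : C (e' i) by rewrite CE; exists i.
move=> /CB[Bi|->]; last exact: Or33.
by have [->|ne] := pselect (e' i = e); [apply: Or32|apply: Or31].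
Qed.

Lemma cycle_circuit F : cycle_edges F ->
  (forall F', cycle_edges F' -> F' `<=` F -> F' = F) -> circuits (M_A G) F.
Proof.
move=> cF Fmin; split=> [iF|Y /existsNP[F' /not_implyP[cF' /contrapT F'Y]] YF].
  by apply: (iF F) => //; left.
have F'F : F' = F.
  have F'F := subset_trans F'Y YF.
  case: cF' => [cF'|/double_ray_infinite[]]; first exact: Fmin.
  exact: sub_finite_set F'F (cycle_finite cF).
by apply/seteqP; split=> //; rewrite -F'F.
Qed.

(** The connected rayless set [S] meets one tail of the double ray infinitely often
    and the other tail not at all, as in the Bean graph. Extend the tree on [S] to a rayless tree [T'] that includes all
    vertices of the double ray from its first contact [v n0] on. Together with the
    remaining tail, this tree is independent. Hence some cocircuit meets this
    independent set only in the edge [e (n0 - 1)]. On the double ray it has another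
    edge [e i]; but then [e i] is its only edge on a cycle in [T' + e i]. *)
Lemma no_bean v e Y S a : is_double_ray v e -> circuits (M_A G) (range e) ->
    M_A G Y -> rayless Y S -> 
    (forall z, S z -> conn [set f | Y f /\ ends f `<=` S] a z) ->
    (forall n, exists2 i, n <= i & S (v i)) ->
    (exists m, forall i, i <= m -> ~ S (v i)) ->
  False.
Proof.
set T := [set f | _] => vray cC iY rl Sconn Sup [m mS].
have [vinj eE] := vray; have einj := ray_edge_inj vray.
have [n0 Sn0 nSn0] : exists2 n0, S (v n0) & forall i, i < n0 -> ~ S (v i).
  have exn : exists n : nat, `[< S (v (m + n%:Z)) >].
    have [i mi Si] := Sup m; exists `|i - m|%N; apply/asboolP.
    by have -> : m + `|i - m|%:Z = i by lia.
  have [n /asboolP Sn nmin] := ex_minnP exn; exists (m + n%:Z) => // i im Si.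
  have [mi|mi] : i <= m \/ m <= i by lia.
    exact: mS Si.
  suff : (n <= `|i - m|)%N by lia.
  by apply: nmin; apply/asboolP; have -> : m + `|i - m|%:Z = i by lia.
pose T' : set (edge G) :=
  [set f | T f \/ exists i, [/\ n0 <= i, e i = f & ~ S (v (i + 1))]].
pose S' : set (vertex G) := [set z | S z \/ exists2 i, n0 <= i & v i = z].
have vS' i : S' (v i) <-> n0 <= i.
  split=> [[Si|[j nj /vinj <-] //]|ni]; last by right; exists i.
  have [//|ni] : n0 <= i \/ i < n0 by lia.
  by case: (nSn0 i ni).
(* A walk in [T'] that leaves [S] along the double ray ends at the last vertex
   before the next contact with [S]. *)
have gap n i : n0 <= i -> ~ S (v (i + 1)) -> S (v (i + 1 + n%:Z)) ->
    Acc (fun q p => step T' p q) (e i, v (i + 1)).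
  elim: n i => [|n IHn] i ni nSi; first by rewrite addr0.
  move=> Sin; split=> -[h u] [/= [[Yh hS]|[j [nj <- nSj]]] hi hE].
    by case: nSi; apply: hS; rewrite hE; left.
  case: (set2_eq (etrans (esym (eE j)) hE)) => [[/vinj ji <-]|[_ /vinj ji]].
    rewrite ji in nSj *; apply: IHn => //; first by lia.
    by have <- : i + 1 + n.+1%:Z = i + 1 + 1 + n%:Z by lia.
  by case: hi; congr e; lia.
have gapA i : n0 <= i -> ~ S (v (i + 1)) ->
    Acc (fun q p => step T' p q) (e i, v (i + 1)).
  move=> ni nSi; have [j ij Sj] := Sup (i + 1).
  apply: (gap `|j - i|.-1%N i ni nSi).
  by have -> : i + 1 + `|j - i|.-1%:Z = j by lia.
have ST' p : Acc (fun q p => step Y p q) p -> S p.2 ->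
    Acc (fun q p => step T' p q) p.
  elim=> {}p _ IH Sp; split=> -[h u] [/= [[Yh hS]|[j [nj hj nSj]]] hp hE].
    by apply: IH; [split|apply: hS; rewrite hE; right].
  rewrite -hj in hE *.
  case: (set2_eq (etrans (esym (eE j)) hE)) => [[_ <-]|[_ vj]]; first exact: gapA.
  by case: nSj; rewrite vj.
(* From a vertex outside [S], a walk can also go back along the double ray, and
   then it reaches [S] after finitely many steps. *)
have rl' : rayless T' S'.
  have vA n g : Acc (fun q p => step T' p q) (g, v (n0 + n%:Z)).
    elim: n g => [|n IHn] g; first by rewrite addr0; exact: ST' (rl _ _ Sn0) Sn0.
    have [Sn|nSn] := pselect (S (v (n0 + n.+1%:Z))).
      exact: ST' (rl _ _ Sn) Sn.
    split=> -[h u] [/= [[Yh hS]|[j [nj hj nSj]]] hp hE].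
      by case: nSn; apply: hS; rewrite hE; left.
    rewrite -hj in hE *.
    case: (set2_eq (etrans (esym (eE j)) hE)) => [[_ <-]|[<- /vinj vj]]; first exact: gapA.
    by have -> : j = n0 + n%:Z by lia.
  move=> z g [Sz|[i ni <-]]; first exact: ST' (rl _ _ Sz) Sz.
  by have -> : i = n0 + `|i - n0|%:Z by lia.
have conn' z : S' z -> conn T' a z.
  have TT' : T `<=` T' by left.
  have connv n : conn T' a (v (n0 + n%:Z)).
    elim: n => [|n IHn]; first by rewrite addr0; apply: (connW TT'); apply: Sconn.
    have [Sn|nSn] := pselect (S (v (n0 + n.+1%:Z))).
      by apply: (connW TT'); apply: Sconn.
    have E : n0 + n.+1%:Z = n0 + n%:Z + 1 by lia.
    rewrite E in nSn *; apply: (connS IHn _ (eE _)).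
    by right; exists (n0 + n%:Z); split=> //; lia.
  move=> [Sz|[i ni <-]]; first by apply: (connW TT'); apply: Sconn.
  by have -> : i = n0 + `|i - n0|%:Z by lia.
have T'S' f : T' f -> ends f `<=` S'.
  move=> [[_ fS] z /fS Sz|[i [ni <- _]] z]; first by left.
  by rewrite eE => -[->|->]; apply/vS'; lia.
have T'loopless g z : T' g -> ends g <> [set z; z].
  move=> [[Yg _]|[i [ni <- _]]]; first exact: M_A_loopless iY Yg.
  by rewrite eE => E; case: (set2_eq E) => -[<- /vinj]; lia.
pose R := [set e i | i in [set i | i < n0 - 1]].
pose e0 := e (n0 - 1); pose X := T' `|` R `|` [set e0].
have RS' f z : R f -> ends f z -> ~ S' z.
  by move=> [i /= ni <-]; rewrite eE => -[->|->] /vS'; lia.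
have cutX f : X f -> cut_of S' f -> f = e0.
  move=> [[T'f|Rf]|//] [[z [fz Sz]] [y [fy nSy]]].
    by case: nSy; apply: T'S' fy.
  by case: (RS' f z).
have nT'e0 : ~ T' e0.
  move=> /T'S' /(_ (v (n0 - 1))); rewrite /e0 eE => /(_ (or_introl erefl)) /vS'.
  by lia.
have eoutR F : cycle_edges F \/ double_ray_edges F -> ~ F `<=` R.
  move=> cF FR; have RC : R `<=` range e by move=> _ [i _ <-]; exists i.
  have FC : F = range e.
    by apply: cC.2; [move=> iF; apply: (iF F)|apply: subset_trans RC].
  have : R e0 by apply: FR; rewrite FC; exists (n0 - 1).
  by move=> [i /= ni /einj]; lia.
have inS' F : F `<=` X -> ~ F `<=` R -> exists f z, [/\ F f, ends f z & S' z].
  move=> FX /existsNP[f /not_implyP[Ff nRf]]; case: (FX f Ff) => [[T'f|//]|fe0].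
    have [u [w fE]] := endsP f; exists f, u; split=> //; first by rewrite fE; left.
    by apply: (T'S' f T'f); rewrite fE; left.
  exists f, (v n0); split=> //; last by apply/vS'.
  by rewrite fe0 /e0 eE; right; congr v; lia.
(* A cycle or double ray in [X] crosses the boundary of [S'] at most in [e0], so it
   lies in [T'], has a tail in [T'], or lies in the other tail of the double ray,
   which is a proper subset of the circuit [range e]. *)
have iX : M_A G X.
  move=> F cF FX; have := eoutR F cF => /(inS' F FX)[f [z [Ff fz S'z]]].
  have XT' g : X g -> ends g `<=` S' -> T' g.
    move=> Xg gS'; case: (Xg) => [[//|Rg]|ge0].
      by have [u [w gE]] := endsP g; case: (RS' g u Rg); [|apply: gS']; rewrite gE; left.
    exfalso; have : S' (v (n0 - 1)) by apply: gS'; rewrite ge0 /e0 eE; left.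
    by move=> /vS'; lia.
  case: cF => [cF|[w [h [winj hE FE]]]].
    have Fcut g : F g -> ~ cut_of S' g.
      move=> Fg Sg; have ge0 := cutX g (FX g Fg) Sg.
      have [c fc cE] := cycle_flow k cF.
      apply: (orth_neq1 (flow_orth (ind k S') fc) (e := g)).
      rewrite cE supp_delta_ind; apply/seteqP; split=> y; last by move=> ->.
      by move=> [/FX Xy /(cutX y Xy) ->].
    move: cF => [n [w [h [winj hinj hE FE]]]].
    have wS' j : S' (w j) <-> S' (w (ordS j)).
      apply: contrapT => nS; apply: (Fcut (h j)); first by rewrite FE; exists j.
      by rewrite (cut_ofP _ (hE j)).
    have [i S'i] : exists i, S' (w i).
      move: Ff fz; rewrite FE => -[j _ <-]; rewrite hE => -[zj|zj].
        by exists j; rewrite -zj.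
      by exists (ordS j); rewrite -zj.
    apply: (rayless_no_cycle hinj hE T'loopless rl' S'i) => j S'j.
    have S'j1 := (wS' j).1 S'j; split=> //; apply: XT'.
      by apply: FX; rewrite FE; exists j.
    by rewrite hE => y [->|->].
  have hray : is_double_ray w h by [].
  have [i0 cut1] : exists i0, forall i, cut_of S' (h i) -> i = i0.
    have hcut i : cut_of S' (h i) -> h i = e0.
      by apply: cutX; apply: FX; rewrite FE; exists i.
    have [[i0 hi0]|nh] := pselect (exists i0, h i0 = e0).
      by exists i0 => i /hcut; rewrite -hi0; apply: (ray_edge_inj hray).
    by exists 0 => i /hcut hi; case: nh; exists i.
  have [i S'i] : exists i, S' (w i).
    move: Ff fz; rewrite FE => -[j _ <-]; rewrite hE => -[zj|zj].
      by exists j; rewrite -zj.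
    by exists (j + 1); rewrite -zj.
  have [b bS'] := ray_side hray cut1 S'i.
  apply: (rayless_no_tail (f1 := e0) (f2 := e0) hray rl' _ bS') => j S'j S'j1.
  apply: Or31; apply: XT'; first by apply: FX; rewrite FE; exists j.
  by rewrite hE => y [->|->].
have [B bB XB] := base_extend matA iX.
have Be0 : B e0 by apply: XB; right.
have [D [cD De0 DB]] := fundamental_cocircuit matA bB Be0.
have [i [Di i0]] : exists i, D (e i) /\ i <> n0 - 1.
  apply: contrapT => nex; apply: (circuit_cocircuit_neq1 matA cC cD (e := e0)).
  apply/seteqP; split=> f; last by move=> ->; split=> //; exists (n0 - 1).
  move=> [[i _ <-] Di]; have [->//|i0] := pselect (i = n0 - 1).
  by case: nex; exists i.
have nBi : ~ B (e i).
  move=> Bi; apply: i0; apply: einj; have : (D `&` B) (e i) by [].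
  by rewrite DB.
have ni : n0 <= i.
  have [//|ni] : n0 <= i \/ i < n0 - 1 by lia.
  by case: nBi; apply/XB; left; right; exists i.
have nT'i : ~ T' (e i) by move=> T'i; apply: nBi; apply/XB; left; left.
have ii1 : conn T' (v i) (v (i + 1)).
  by apply: (conn_trans (conn_sym (conn' _ _))); [|apply: conn']; apply/vS'; lia.
have [w [fw wT' wi]] := conn_flow k ii1 (eE i) nT'i.
have [F [cF Fi Fw Fmin]] := flow_cycle fw wi.
apply: (circuit_cocircuit_neq1 matA (cycle_circuit cF Fmin) cD (e := e i)).
apply/seteqP; split=> f; last by move=> ->.
move=> [/Fw/wT'[T'f|//] Df]; exfalso; apply: nT'e0.
have : (D `&` B) f by split=> //; apply: XB; left; left.
by rewrite DB => <-.
Qed.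

(** ** Infinitely many disjoint branches at one vertex *)

Section Star.
Variables (Y : set (edge G)) (U : set (vertex G)).
Hypothesis iY : M_A G Y.

(** The edges at [a] that lead to vertices of [U]. *)
Definition branches a : set (edge G) := [set f | Y f /\
  exists u, ends f = [set a; u] /\ exists2 z, U z & conn (Y `\ f) u z].

Lemma conn_branch g a z : conn (Y `\ g) a z -> z = a \/
  exists f u, [/\ Y f, f <> g, ends f = [set a; u] & conn (Y `\ f) u z].
Proof.
elim=> [|b c h ab [->|[f [u [Yf fg fE ub]]]] [Yh hg] hE]; first by left.
  by right; exists h, c; split=> //; apply: conn0.
have [hf|hf] := pselect (h = f); last first.
  by right; exists f, u; split=> //; apply: (connS ub) hE.
have : [set b; c] c by right.
rewrite -hE hf fE => -[->|->]; first by left.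
by right; exists f, u; split=> //; apply: conn0.
Qed.

(** Induction along the well-founded step relation: unless infinitely many edges
    at [a] lead to [U], one of finitely many branches has infinitely many
    vertices of [U]. *)
Lemma star_vertex p : Acc (fun q p => step Y p q) p ->
    infinite_set [set z | U z /\ conn (Y `\ p.1) p.2 z] ->
  exists a, conn Y p.2 a /\ infinite_set (branches a).
Proof.
elim=> -[g a] _ IH /= inf; have [fin|nfin] := pselect (finite_set (branches a)); last first.
  by exists a; split=> //; apply: conn0.
pose V f := [set z | U z /\ exists u, [/\ Y f, f <> g, ends f = [set a; u] & conn (Y `\ f) u z]].
have [[f Vf]|nV] := pselect (exists f, infinite_set (V f)).
  have [z [Uz [u [Yf fg fE uz]]]] := infinite_setN0 Vf.
  have [||b [ub bb]] := IH (f, u).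
  - by split.
  - move=> /= fin'; apply: Vf; apply: sub_finite_set fin' => y [Uy [u' [_ _ fE' u'y]]].
    by have -> : u = u' by apply: (@set2_other _ a); rewrite -fE -fE'.
  by exists b; split=> //; apply: conn_trans (conn_edge Yf fE) ub.
exfalso; apply: inf.
apply: (@sub_finite_set _ _ ([set a] `|` \bigcup_(f in branches a) V f)).
  move=> z [Uz /conn_branch[->|[f [u [Yf fg fE uz]]]]]; first by left.
  right; exists f; last by split=> //; exists u.
  by split=> //; exists u; split=> //; exists z.
rewrite finite_setU; split=> //; apply: bigcup_finite => // f _.
by apply: contrapT => Vf; apply: nV; exists f.
Qed.

Lemma branch_avoid f a u z : Y f -> ends f = [set a; u] -> conn (Y `\ f) u z ->
  conn [set h | Y h /\ ~ ends h a] u z.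
Proof.
move=> Yf fE; elim=> [|b c h ub IH [Yh hf] hE]; first exact: conn0.
apply: (connS IH _ hE); split=> //; rewrite hE => abc.
apply: (M_A_acyclic iY Yf (ends_sym fE)).
by case: abc => ->; [|apply: connS ub _ hE].
Qed.

(** A branch avoids [a], so two branches with a common vertex would be joined to
    a cycle through [a]. *)
Lemma branch_disjoint f f' a u u' z : Y f -> Y f' -> ends f = [set a; u] ->
  ends f' = [set a; u'] -> conn (Y `\ f) u z -> conn (Y `\ f') u' z -> f = f'.
Proof.
move=> Yf Yf' fE f'E uz u'z; apply: contrapT => ff'.
apply: (M_A_acyclic iY Yf (ends_sym fE)).
have uu' := conn_trans (branch_avoid Yf fE uz) (conn_sym (branch_avoid Yf' f'E u'z)).
apply: (connS (z := u') (f := f')); last by rewrite f'E setUC.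
  apply: connW uu' => h [Yh ha]; split=> // hf; apply: ha.
  by rewrite hf fE; left.
by split=> // /esym.
Qed.

(** The part of the tree around [a] before the first vertices of [U] other than
    [a], and these first vertices. *)
Definition core a : set (vertex G) :=
  conn [set f | Y f /\ forall z, ends f z -> U z -> z = a] a.

Definition first_hits a : set (vertex G) :=
  [set w | U w /\ exists z f, [/\ core a z, Y f & ends f = [set z; w]]].

Lemma core_hit a z : core a z -> U z -> z = a.
Proof. by case=> [//|b c f _ [_ fU] fE]; apply: fU; rewrite fE; right. Qed.

(** Otherwise the branch would be included in [core a], which avoids [U]. *)
Lemma branch_first_hit f a : branches a f ->
  exists2 w, first_hits a w & Y f /\ exists u, ends f = [set a; u] /\ conn (Y `\ f) u w.
Proof.
move=> [Yf [u [fE [z Uz uz]]]]; apply: contrapT => /forall2NP nw.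
have na y : conn (Y `\ f) u y -> y <> a.
  by move=> uy ya; apply: (M_A_acyclic iY Yf (ends_sym fE)); rewrite -ya.
have nfirst y : conn (Y `\ f) u y -> ~ first_hits a y.
  by move=> uy hy; case: (nw y) => // -[]; split=> //; exists u.
suff [_] : core a z /\ ~ U z by [].
elim: uz {Uz} => [|b c h ub [cb nUb] [Yh hf] hE].
  have nUu : ~ U u.
    move=> Uu; apply: (nfirst u (conn0 _ _)); split=> //.
    by exists a, f; split=> //; apply: conn0.
  split=> //; apply: (connS (conn0 _ _) _ fE); split=> // y; rewrite fE => -[->//|-> //].
have uc : conn (Y `\ f) u c by apply: connS ub _ hE.
have nUc : ~ U c by move=> Uc; apply: (nfirst c uc); split=> //; exists b, h.
by split=> //; apply: (connS cb _ hE); split=> // y; rewrite hE => -[->//|-> //].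
Qed.

Lemma first_hits_infinite a : infinite_set (branches a) -> infinite_set (first_hits a).
Proof.
move=> inf fin; apply: inf.
pose V w := [set f | Y f /\ exists u, ends f = [set a; u] /\ conn (Y `\ f) u w].
apply: (@sub_finite_set _ _ (\bigcup_(w in first_hits a) V w)).
  by move=> f /branch_first_hit[w hw Vw]; exists w.
apply: bigcup_finite => // w _; apply: finite_subsingleton => f f' [Yf [u [fE uw]]].
by move=> [Yf' [u' [f'E u'w]]]; apply: branch_disjoint fE f'E uw u'w.
Qed.

End Star.

(** Let [a] be a vertex whose branches meet the double ray infinitely often. Each
    branch has its own first vertex on the double ray, and infinitely many of
    these lie on the same side of [a]. The core of [a] together with the first
    hits far enough on this side avoids the other tail, which [no_bean] excludes. *)
Lemma ray_meets_rayless_finitely v e Y x g : is_double_ray v e -> circuits (M_A G) (range e) ->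
    M_A G Y -> ~ Y g -> rayless Y (conn Y x) ->
  finite_set [set i | conn Y x (v i)].
Proof.
move=> vray cC iY nYg rl; apply: contrapT => inf.
pose U := range v.
have [a [xa inf_a]] : exists a, conn Y x a /\ infinite_set (branches Y U a).
  apply: (star_vertex (p := (g, x))) => [|/= fin]; first exact/rl/conn0.
  apply: inf; apply: sub_finite_set (finite_preimage _ fin); last first.
    by move=> i j _ _; apply: vray.1.
  move=> i xi; split; first by exists i.
  by apply: connW xi => f Yf; split=> // fg; apply: nYg; rewrite -fg.
have {inf_a} hits := first_hits_infinite iY inf_a.
have coreY z : core Y U a z -> conn Y x z.
  by move=> az; apply: (conn_trans xa); apply: connW az => f [].
have up v' e' : is_double_ray v' e' -> range e' = range e -> range v' = U ->
    ~ forall n, exists2 i, n <= i & first_hits Y U a (v' i).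
  move=> v'ray e'E v'E hitsup; have vinj := v'ray.1.
  have [m ma] : exists m, forall i, i <= m -> v' i <> a.
    have [[j <-]|nj] := pselect (exists j, v' j = a).
      by exists (j - 1) => i ij /vinj; lia.
    by exists 0 => i _ ia; apply: nj; exists i.
  pose S : set (vertex G) := [set z | core Y U a z \/
    (first_hits Y U a z /\ exists2 i, m < i & v' i = z)].
  have cS z : core Y U a z -> conn [set f | Y f /\ ends f `<=` S] a z.
    elim=> [|b c f ab IH [Yf fU] fE]; first exact: conn0.
    apply: (connS IH _ fE); split=> // y; rewrite fE => -[->|->]; left=> //.
    by apply: connS ab _ fE.
  have e'C : circuits (M_A G) (range e') by rewrite e'E.
  apply: (no_bean (S := S) (a := a) v'ray e'C iY).
  - move=> z h Sz; apply: rl; case: Sz => [/coreY //|[[_ [b [f [cb Yf fE]]]] _]].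
    by apply: connS (coreY _ cb) Yf fE.
  - move=> z [/cS //|hz]; have [[Uz [b [f [cb Yf fE]]]] _] := hz.
    apply: (connS (cS b cb) _ fE); split=> // y; rewrite fE => -[->|->]; first by left.
    by right.
  - move=> n; have [i ni hi] := hitsup (`|n| + `|m| + 1).
    exists i; first by lia.
    by right; split=> //; exists i => //; lia.
  - exists m => i im [ci|[_ [j mj /vinj]]]; last by lia.
    apply: (ma i im); apply: core_hit ci _.
    by rewrite -v'E; exists i.
have [] : (forall n, exists2 i, n <= i & first_hits Y U a (v i)) \/
          (forall n, exists2 i, i <= n & first_hits Y U a (v i)).
- apply: int_unbounded => fin; apply: hits; apply: sub_finite_set (finite_image v fin).
  by move=> w hw; have [[i _ iw] _] := hw; exists i => //=; rewrite iw.
- exact: (up v e vray erefl erefl).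
- move=> down; apply: (up _ _ (ray_rev vray)).
  + exact: ray_rev_range.
  + exact: ray_rev_vrange.
  + move=> n; have [i ni hi] := down (- n); exists (- i); first by lia.
    by rewrite opprK.
Qed.

Lemma sum_shift (h : int -> k) : finite_set [set i | h i != 0] ->
  \sum_(i \in [set: int]) (h (i + 1) - h i) = 0.
Proof.
move=> fh; pose A := [set i | h i != 0] `|` [set i | h (i + 1) != 0].
have fA : finite_set A.
  rewrite finite_setU; split=> //.
  by apply: (@finite_preimage _ _ _ (fun i => i + 1)) fh => i j _ _; lia.
have A0 i : ~ A i -> h i = 0 /\ h (i + 1) = 0.
  by move=> /not_orP[/negP + /negP]; rewrite !negbK => /eqP -> /eqP ->.
have widen (g : int -> k) : (forall i, ~ A i -> g i = 0) ->
    \sum_(i \in [set: int]) g i = \sum_(i \in A) g i.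
  by move=> g0; apply/esym/fsbig_widen => // i [_ /g0].
rewrite widen => [|i /A0[-> ->]]; last by rewrite subrr.
rewrite fsbig_split //= -(widen (fun i => h (i + 1))) => [|i /A0[] //].
have -> : \sum_(i \in A) - h i = - \sum_(i \in A) h i.
  by rewrite -mulN1r mulr_fsumr; apply: eq_fsbigr => i _; rewrite mulN1r.
rewrite -(widen h) => [|i /A0[] //].
rewrite [X in _ - X](_ : _ = \sum_(i \in [set: int]) h (i + 1)) ?subrr //.
apply: (@reindex_fsbigT _ _ _ _ _ (fun i : int => i + 1)).
by apply: (Bijective (g := fun i : int => i - 1)) => i; lia.
Qed.

Definition ray_flow C (c : edge G -> k) := exists v e,
  [/\ is_double_ray v e, C = range e & forall i g, c (e i) * delta g (e i) = g (v (i + 1)) - g (v i)].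

Lemma ray_flow_orth C c S : supp c = C -> ray_flow C c ->
    (forall v e, is_double_ray v e -> C = range e -> finite_set [set i | S (v i)]) ->
  orth c (delta (ind k S)).
Proof.
move=> cC [v [e [vray CE cE]]] Sfin; have fin := Sfin v e vray CE.
have einj := ray_edge_inj vray.
have fin1 : finite_set [set i | S (v (i + 1))].
  by apply: (@finite_preimage _ _ _ (fun i => i + 1)) fin => i j _ _; lia.
split.
  apply: (@sub_finite_set _ _ (e @` ([set i | S (v i)] `|` [set i | S (v (i + 1))]))).
    move=> f /= cf; have cf0 : supp c f by apply: contra_neq cf => ->; rewrite mul0r.
    move: cf0 cf; rewrite cC CE => -[i _ <-]; rewrite cE => Si.
    exists i => //; apply: contrapT => /not_orP[/= nSi nSi1].
    by move: Si; rewrite /ind !asboolF // subrr eqxx.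
  by apply: finite_image; rewrite finite_setU.
rewrite (sum_directed einj (v := v) (w := fun i => v (i + 1))); first last.
- by move=> i; rewrite cE.
- by rewrite cC.
apply: (sum_shift (h := fun i => ind k S (v i))); apply: sub_finite_set fin => i /=.
by rewrite /ind; case: asboolP => //; rewrite eqxx.
Qed.

Lemma M_A_painted : painted k (M_A G).
Proof.
exists [set c | circuits (M_A G) (supp c) /\ (flow c \/ ray_flow (supp c) c)].
exists [set d | exists S, d = delta (ind k S) /\ forall v e, is_double_ray v e ->
  circuits (M_A G) (range e) -> finite_set [set i | S (v i)]].
split=> [C cC|D cD|c _ [cc fc] [S [-> Sfin]]].
- case: (M_A_circuit cC) => [cycC|[v [e [vinj eE CE]]]].
    by have [c fc cE] := cycle_flow k cycC; exists c => //; rewrite /mkset cE; split=> //; left.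
  have vray : is_double_ray v e by [].
  have [c [ce cE]] := directed_edges k (ray_edge_inj vray) eE.
  exists c; last by rewrite ce.
  by rewrite /mkset ce -CE; split=> //; right; exists v, e.
- have [Y [g [x [iY nYg rl DE]]]] := M_A_cocircuit cD.
  exists (delta (ind k (conn Y x))); last by rewrite supp_delta_ind.
  exists (conn Y x); split=> // v e vray cC.
  exact: ray_meets_rayless_finitely vray cC iY nYg rl.
- case: fc => [fc|rc]; first exact: flow_orth.
  by apply: (ray_flow_orth erefl rc) => v e vray cE; apply: Sfin vray _; rewrite -cE.
Qed.

End AlgebraicCycles.

Theorem mainTheorem5 (k : fieldType) (G : graph) :
  [/\ tame_thin_sums_matroid k (M_FC G),
      tame_thin_sums_matroid k (M_B G),
      tame_thin_sums_matroid k (M_FB G)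
    & tame_thin_sums_matroid k (M_C G)] /\
  (is_matroid (M_A G) ->
     tame_thin_sums_matroid k (M_A G) /\
     tame_thin_sums_matroid k (dual (M_A G))).
Proof.
have both (M : set (set (edge G))) : is_matroid M -> painted k M ->
    tame_thin_sums_matroid k M /\ tame_thin_sums_matroid k (dual M).
  move=> matM pM; split; first exact: painted_tame_thin_sums.
  by apply: painted_tame_thin_sums; [apply: dual_matroid|apply: painted_dual].
split=> [|matA]; last by apply: both => //; apply: M_A_painted.
have [FC B] := both _ (M_FC_matroid k G) (M_FC_painted k G).
have [FB C] := both _ (M_FB_matroid k G) (M_FB_painted k G).
by split=> //; rewrite (M_B_dual k).
Qed.
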